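(* There is a constant $C$ such that for every integer $N \ge 2$ there exists a restricted glue tile assembly system (rgTAS) $\mathcal{T}_N = (T_N, \sigma, 1)$ with $|T_N| \le C \frac{\log N}{\log \log N}$ that is directed (has exactly one terminal assembly) and in which the square $S_N = \{0,1,\ldots,N-1\} \times \{0,1,\ldots,N-1\}$ strictly self-assembles, i.e. the unique terminal assembly $\alpha$ satisfies $\operatorname{dom}\alpha = S_N$.
   Context: Abstract Tile Assembly Model (aTAM) in $\mathbb{Z}^2$. A tile type is a unit square that can be translated but not rotated; each of its four sides $\vec u \in \{(0,1),(1,0),(0,-1),(-1,0)\}$ carries a glue, consisting of a label (color) from a fixed alphabet and an integer strength. Two tiles placed at adjacent positions $\vec a$ and $\vec a+\vec u$ interact with strength $s$ iff the glue on side $\vec u$ of the first and the glue on side $-\vec u$ of the second have the same label and the same strength $s$; otherwise they interact with strength $0$. An assembly is a partial function $\alpha:\mathbb{Z}^2 \rightharpoonup T$ ($\operatorname{dom}\alpha$ = occupied positions). A tile assembly system (TAS) is a triple $(T,\sigma,\tau)$: a finite set $T$ of tile types, a finite seed assembly $\sigma$ (here a single tile), and a temperature $\tau\in\mathbb{N}$. Growth is irreversible: starting from $\sigma$, tiles are added one at a time; a tile of type $t$ may be placed at an empty position $\vec x$ iff the sum of the interaction strengths (positive and negative) between $t$ at $\vec x$ and the tiles already present at the (up to four) neighbors of $\vec x$ is at least $\tau$; placed tiles never detach. An assembly sequence is a sequence of assemblies obtained this way; an assembly is producible if it is reachable from $\sigma$, and terminal if no tile can be added. The TAS is directed if it has exactly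 one terminal assembly. A set $X\subseteq\mathbb{Z}^2$ strictly self-assembles if every terminal assembly $\alpha$ has $\operatorname{dom}\alpha = X$. A tile set (and the TAS $(T,\sigma,1)$ using it) is glue restricted, or an rgTAS, if (1) every glue strength has absolute value $1$, (2) the glue function is diagonal: a glue interacts only with an identical glue (strength $0$ with any other glue), and (3) there is exactly one glue type of negative strength, namely strength $-1$. Logarithms are base 2. *)

(* Defs.v *)
From Stdlib Require Import Reals ZArith List.
Open Scope Z_scope.

Inductive dir : Type := DN | DE | DS | DW.

Definition dvec (d : dir) : Z * Z :=
  match d with DN => (0, 1) | DE => (1, 0) | DS => (0, -1) | DW => (-1, 0) end.

Definition dopp (d : dir) : dir :=
  match d with DN => DS | DE => DW | DS => DN | DW => DE end.

Definition all_dirs : list dir := DN :: DE :: DS :: DW :: nil.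

Definition zpos := (Z * Z)%type.
Definition padd (a b : zpos) : zpos := (fst a + fst b, snd a + snd b).

Record glue : Type := mkGlue { glabel : nat; gstrength : Z }.

Record tile : Type := mkTile { gN : glue; gE : glue; gS : glue; gW : glue }.

Definition tglue (t : tile) (d : dir) : glue :=
  match d with DN => gN t | DE => gE t | DS => gS t | DW => gW t end.

Definition glue_eqb (g h : glue) : bool :=
  Nat.eqb (glabel g) (glabel h) && Z.eqb (gstrength g) (gstrength h).

Definition interact (t : tile) (d : dir) (t' : tile) : Z :=
  let g := tglue t d in
  let g' := tglue t' (dopp d) in
  if glue_eqb g g' then gstrength g else 0.

Definition assembly := zpos -> option tile.

Definition aeq (a b : assembly) : Prop := forall x, a x = b x.

Definition nbr_strength (a : assembly) (x : zpos) (t : tile) : Z :=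
  fold_right Z.add 0
    (map (fun d => match a (padd x (dvec d)) with
                   | Some t' => interact t d t'
                   | None => 0
                   end) all_dirs).

Definition attachable (T : list tile) (tau : Z) (a : assembly) (x : zpos) (t : tile) : Prop :=
  In t T /\ a x = None /\ tau <= nbr_strength a x t.

Definition step (T : list tile) (tau : Z) (a b : assembly) : Prop :=
  exists x t, attachable T tau a x t /\ b x = Some t /\
              (forall y, y <> x -> b y = a y).

Definition single_seed (t : tile) (p : zpos) : assembly :=
  fun x => if (Z.eqb (fst x) (fst p) && Z.eqb (snd x) (snd p))%bool
           then Some t else None.

(** An assembly sequence (finite or infinite: finite sequences are encoded by
    eventually stuttering) starting at the seed. *)
Definition assembly_seq (T : list tile) (tau : Z) (sigma : assembly)
    (s : nat -> assembly) : Prop :=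
  aeq (s O) sigma /\
  forall n, aeq (s (S n)) (s n) \/ step T tau (s n) (s (S n)).

Definition seq_result (s : nat -> assembly) (a : assembly) : Prop :=
  forall x t, a x = Some t <-> exists n, s n x = Some t.

Definition producible (T : list tile) (tau : Z) (sigma : assembly) (a : assembly) : Prop :=
  exists s, assembly_seq T tau sigma s /\ seq_result s a.

Definition terminal (T : list tile) (tau : Z) (a : assembly) : Prop :=
  forall x t, ~ attachable T tau a x t.

Definition terminal_assembly (T : list tile) (tau : Z) (sigma a : assembly) : Prop :=
  producible T tau sigma a /\ terminal T tau a.

Definition directed (T : list tile) (tau : Z) (sigma : assembly) : Prop :=
  exists a, terminal_assembly T tau sigma a /\
    forall b, terminal_assembly T tau sigma b -> aeq a b.

Definition strictly_self_assembles (T : list tile) (tau : Z) (sigma : assembly)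
    (X : zpos -> Prop) : Prop :=
  forall a, terminal_assembly T tau sigma a ->
    forall x, a x <> None <-> X x.

Definition square (N : Z) (x : zpos) : Prop :=
  0 <= fst x < N /\ 0 <= snd x < N.

(** Glue restricted tile set: (1) all glue strengths have absolute value 1,
    (2) the glue function is diagonal (built into [interact]),
    (3) exactly one glue type of negative strength, namely strength -1. *)
Definition glue_restricted (T : list tile) : Prop :=
  (forall t d, In t T -> Z.abs (gstrength (tglue t d)) = 1) /\
  (exists l : nat,
     (exists t d, In t T /\ tglue t d = mkGlue l (-1)) /\
     (forall t d, In t T -> gstrength (tglue t d) < 0 -> tglue t d = mkGlue l (-1))).

Definition log2r (x : R) : R := (ln x / ln 2)%R.

(* Main.v *)
Require Import Defs.
From Stdlib Require Cantor.
From Stdlib Require Import Reals ZArith List Lia Lra Classical FunctionalExtensionality Wellfounded.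
Import ListNotations.
Open Scope bool_scope.
Open Scope Z_scope.

(* A tile that shows the negative glue to a placed neighbour showing it too (a "guard") loses one
   unit of strength, so at temperature 1 it needs two positive bonds: the single negative glue
   yields cooperative attachment in guarded cells.

   A single path grows four thin strips, each the image of the previous one under a quarter turn of
   the square, which close a pinwheel around the interior.  A strip is a zigzag counter with k
   digits in base b.  A pass writes every digit as a positive glue at the bottom of a pit whose
   wall, placed just before the digit, is a guard; the next pass, running in the opposite direction,
   fills the pit with a tile determined by the digit and by the carry it brings along.  Passes
   alternately increment and copy, and the overflow ends the strip.  The starting value is
   hard-coded in the first row, so a strip has a prescribed length at the price of O(k + b) tile
   types.  Once the inner wall of the fourth strip is complete, a column of trunk tiles emits rows
   that fill the interior and are stopped by the walls.  Taking b = k = n for the least n with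
   N <= n ^ n gives O(log N / log log N) tile types. *)

(** * Directed growth from local conditions *)

(** At temperature 1 a single positive bond attaches a tile, and a wrong tile never detaches. Hence
    a guard has to be in place before either of the two bonds that it is meant to couple becomes
    available. Reading is confined to the pits; everywhere else a glue names the full state of the
    next cell, so that the predecessor alone determines the tile. A carry travels from the least
    significant digit upwards, so the passes in the opposite direction can only copy. The marks of
    the two end digits travel with the digits; a pass therefore needs no position counter, and its
    tiles number O(b) rather than O(k b). Only the first row, where each column has its own tiles,
    costs O(k). Trunk and rows offer their own glue again without end, hence they may start only
    after the walls that stop them. They then grow concurrently with the rest of the last strip, so
    the order of growth is partial. The first part isolates the local properties of glues, relative
    to such an order, that force a unique terminal assembly. *)

Lemma dir_eq_dec (d e : dir) : {d = e} + {d <> e}.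
Proof. decide equality. Defined.

Lemma tile_eq_dec (s t : tile) : {s = t} + {s <> t}.
Proof.
  assert (G : forall g h : glue, {g = h} + {g <> h})
    by (decide equality; [apply Z.eq_dec | apply Nat.eq_dec]).
  decide equality.
Defined.

Lemma dopp_involutive (d : dir) : dopp (dopp d) = d.
Proof. now destruct d. Qed.

Lemma dopp_neq (d : dir) : dopp d <> d.
Proof. now destruct d. Qed.

Lemma padd_dopp (x : zpos) (d : dir) : padd (padd x (dvec d)) (dvec (dopp d)) = x.
Proof. destruct x, d; unfold padd; simpl; f_equal; lia. Qed.

Lemma padd_dopp_swap (x y : zpos) (d : dir) :
  x = padd y (dvec d) -> y = padd x (dvec (dopp d)).
Proof. intros ->. symmetry. apply padd_dopp. Qed.

Lemma padd_dir_inj (x : zpos) (d e : dir) : padd x (dvec d) = padd x (dvec e) -> d = e.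
Proof. destruct x, d, e; unfold padd; simpl; intro H; inversion H; auto; lia. Qed.

(** * Tiles described by abstract faces *)

Inductive face (L : Type) : Type := Lab (l : L) | Neg | Null.
Arguments Lab {L} l.
Arguments Neg {L}.
Arguments Null {L}.

(* A glue of strength 0 is not allowed, so a blank side carries one of two positive labels
   that never face each other. *)
Definition face_glue {L} (code : L -> nat) (d : dir) (f : face L) : glue :=
  match f with
  | Lab l => mkGlue (3 + code l) 1
  | Neg => mkGlue 0 (-1)
  | Null => mkGlue (match d with DN | DE => 1 | _ => 2 end) 1
  end.

Definition tile_of {L} (code : L -> nat) (f : dir -> face L) : tile :=
  mkTile (face_glue code DN (f DN)) (face_glue code DE (f DE))
         (face_glue code DS (f DS)) (face_glue code DW (f DW)).

Lemma tglue_tile_of {L} (code : L -> nat) f d :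
  tglue (tile_of code f) d = face_glue code d (f d).
Proof. now destruct d. Qed.

Lemma interact_tile_of {L} (code : L -> nat) f g d :
  interact (tile_of code f) d (tile_of code g) =
  match f d, g (dopp d) with
  | Lab l, Lab l' => if Nat.eqb (code l) (code l') then 1 else 0
  | Neg, Neg => -1
  | _, _ => 0
  end.
Proof.
  unfold interact. rewrite !tglue_tile_of.
  destruct (f d) as [l| |], (g (dopp d)) as [l'| |], d; simpl; try reflexivity;
    unfold glue_eqb; simpl; destruct (Nat.eqb (code l) (code l')); reflexivity.
Qed.

(** * Finite derivations and termination *)

Inductive reach (T : list tile) (sigma : assembly) : assembly -> Prop :=
| reach_refl : reach T sigma sigma
| reach_step a b : reach T sigma a -> step T 1 a b -> reach T sigma b.

Lemma assembly_seq_mono T sigma s : assembly_seq T 1 sigma s ->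
  forall n p x t, s n x = Some t -> s (n + p)%nat x = Some t.
Proof.
  intros [_ Hs] n p x t Hx. induction p as [|p IH].
  - now rewrite Nat.add_0_r.
  - rewrite Nat.add_succ_r. destruct (Hs (n + p)%nat) as [E|(y & u & (_ & Hy & _) & _ & Ho)].
    + now rewrite E.
    + rewrite Ho; [exact IH|]. intros ->. congruence.
Qed.

Lemma reach_assembly_seq T sigma b : reach T sigma b ->
  exists s n, assembly_seq T 1 sigma s /\ forall p, (n <= p)%nat -> s p = b.
Proof.
  induction 1 as [|a b Ha (s & n & [H0 Hs] & Hn) Hab].
  - exists (fun _ => sigma), O. split; [split|]; auto; [now intro|].
    intros _. now left.
  - exists (fun p => if Nat.leb p n then s p else b), (S n). split; [split|].
    + exact H0.
    + intro p. destruct (Nat.leb_spec p n), (Nat.leb_spec (S p) n); try lia; auto.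
      * right. rewrite (Hn p) by lia. exact Hab.
      * left. now intro.
    + intros p Hp. destruct (Nat.leb_spec p n); [lia|auto].
Qed.

Lemma reach_producible T sigma b : reach T sigma b -> producible T 1 sigma b.
Proof.
  intro H. destruct (reach_assembly_seq _ _ _ H) as (s & n & Hs & Hn).
  exists s. split; [exact Hs|]. intros x t. split.
  - intro E. exists n. now rewrite Hn.
  - intros [p E]. rewrite <- (Hn (p + n)%nat) by lia. now apply (assembly_seq_mono _ _ _ Hs).
Qed.

Definition tile_count (cells : list zpos) (a : assembly) : nat :=
  length (filter (fun x => match a x with Some _ => true | None => false end) cells).

Lemma tile_count_step T cells a b : step T 1 a b ->
  (forall x, b x <> None -> In x cells) -> (tile_count cells a < tile_count cells b)%nat.
Proof.
  intros (x & t & (_ & Hx & _) & Hb & Ho) Hc.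
  assert (Hin : In x cells) by (apply Hc; congruence).
  assert (Hle : forall l, (tile_count l a <= tile_count l b)%nat /\
                          (In x l -> (tile_count l a < tile_count l b)%nat)).
  { induction l as [|y l [IH1 IH2]]; simpl; [split; [auto|tauto]|].
    unfold tile_count in *; simpl.
    assert (D : y = x \/ y <> x) by (destruct (classic (y = x)); auto).
    destruct D as [->|D].
    - rewrite Hx, Hb. simpl. split; intros; lia.
    - rewrite (Ho y D). destruct (a y); simpl; (split; [lia|]);
        intros [E|E]; try (now elim D); specialize (IH2 E); lia. }
  now apply Hle.
Qed.

(** Otherwise every reachable assembly could be extended, and [tile_count] would outgrow the number
    of cells. *)
Lemma reach_terminal T sigma cells :
  (forall b, reach T sigma b -> forall x, b x <> None -> In x cells) ->
  exists b, reach T sigma b /\ terminal T 1 b.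
Proof.
  intro Hc. apply NNPP. intro Hno.
  assert (Hgrow : forall n, exists b, reach T sigma b /\ (n <= tile_count cells b)%nat).
  { induction n as [|n (b & Hb & Hn)].
    - exists sigma. split; [constructor|lia].
    - assert (Hnt : ~ terminal T 1 b) by (intro Ht; apply Hno; eauto).
      apply not_all_ex_not in Hnt as [x Hx]. apply not_all_ex_not in Hx as [t Ht].
      apply NNPP in Ht.
      set (b' := fun y => if (Z.eqb (fst y) (fst x) && Z.eqb (snd y) (snd x))%bool
                          then Some t else b y).
      assert (Hst : step T 1 b b').
      { exists x, t. split; [exact Ht|]. unfold b'. split.
        - now rewrite !Z.eqb_refl.
        - intros y Hy. destruct (Z.eqb_spec (fst y) (fst x)), (Z.eqb_spec (snd y) (snd x)); auto.
          elim Hy. destruct x, y; simpl in *; congruence. }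
      assert (Hr : reach T sigma b') by (econstructor; eauto).
      exists b'. split; [exact Hr|].
      pose proof (tile_count_step _ cells _ _ Hst (Hc b' Hr)). lia. }
  destruct (Hgrow (S (length cells))) as (b & _ & Hb).
  assert (tile_count cells b <= length cells)%nat by apply filter_length_le. lia.
Qed.

(** * A criterion for directed growth *)

Section Growth.

Variables (S A L : Type) (code : L -> nat) (edge : L -> bool) (face_of : S -> dir -> face L).
Variables (states : list S) (valid : A -> Prop) (pos : A -> zpos) (st : A -> S).
Variables (lt : A -> A -> Prop) (root : A).

(** Stronger than covering in a partial order: [a] is the greatest valid address below [z], so a
    downward closed assembly that contains [a] contains all that precedes [z]. *)
Definition covers (a z : A) : Prop :=
  lt a z /\ forall y, valid y -> lt y z -> y = a \/ lt y a.

Definition state_tile (s : S) : tile := tile_of code (face_of s).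

Definition tile_set : list tile := nodup tile_eq_dec (map state_tile states).

(* A "reader" is a tile that meets a negative glue of an already placed neighbour, its guard;
   it needs two positive bonds, one of them with a data label. *)
Definition reads (z : A) (s : S) (din : dir) : Prop :=
  exists dg g, dg <> din /\ valid g /\ lt g z /\ pos g = padd (pos z) (dvec dg) /\
    face_of (st g) (dopp dg) = Neg /\ face_of s dg = Neg /\
    forall e a l, valid a -> pos a = padd (pos z) (dvec e) -> edge l = false ->
      face_of s e = Lab l -> face_of (st a) (dopp e) = Lab l -> s = st z.

Hypothesis code_inj : forall l l', code l = code l' -> l = l'.
Hypothesis root_valid : valid root.
Hypothesis root_min : forall z, valid z -> ~ lt z root.
Hypothesis st_states : forall a, valid a -> In (st a) states.
Hypothesis pos_inj : forall a b, valid a -> valid b -> pos a = pos b -> a = b.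
Hypothesis lt_wf : well_founded lt.

Hypothesis parent_spec : forall a, valid a -> a <> root ->
  exists p d l, valid p /\ covers p a /\ pos a = padd (pos p) (dvec d) /\
    edge l = true /\ face_of (st p) d = Lab l /\ face_of (st a) (dopp d) = Lab l.

(** Quantified over all of [states], since the danger is a wrong tile that happens to match; only a
    reader may be left undetermined by an edge label. *)
Hypothesis edge_spec : forall a s d l, valid a -> In s states -> edge l = true ->
  face_of (st a) d = Lab l -> face_of s (dopp d) = Lab l ->
  exists z, valid z /\ pos z = padd (pos a) (dvec d) /\
    (lt z a \/ (covers a z /\ (s = st z \/ reads z s (dopp d)))).

(** Rules out growth from a data label alone: a guard older than [a] cancels the bond, and the
    candidate has no second data side to make up for it. *)
Hypothesis data_spec : forall a s d l, valid a -> In s states -> edge l = false ->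
  face_of (st a) d = Lab l -> face_of s (dopp d) = Lab l ->
  (exists z, valid z /\ pos z = padd (pos a) (dvec d) /\ lt z a) \/
  (exists g dg, valid g /\ lt g a /\ pos g = padd (padd (pos a) (dvec d)) (dvec dg) /\
     face_of (st g) (dopp dg) = Neg /\ face_of s dg = Neg /\
     forall e l', face_of s e = Lab l' -> edge l' = false -> e = dopp d).

(** Ensures that no correct tile is blocked: its negative sides wait for later cells, or a data bond
    pays for its single negative side. *)
Hypothesis neg_spec : forall a, valid a -> a <> root ->
  (forall e, face_of (st a) e = Neg ->
     exists r, valid r /\ pos r = padd (pos a) (dvec e) /\ lt a r) \/
  (exists dg dd b l, (forall e, face_of (st a) e = Neg -> e = dg) /\
     valid b /\ lt b a /\ pos b = padd (pos a) (dvec dd) /\ edge l = false /\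
     face_of (st a) dd = Lab l /\ face_of (st b) (dopp dd) = Lab l).

Definition bond (a : assembly) (x : zpos) (s : S) (e : dir) : Z :=
  match a (padd x (dvec e)) with
  | Some t => interact (state_tile s) e t
  | None => 0
  end.

Lemma nbr_strength_bond a x s :
  nbr_strength a x (state_tile s) = bond a x s DN + bond a x s DE + bond a x s DS + bond a x s DW.
Proof. unfold nbr_strength, bond, all_dirs. cbn [map fold_right]. lia. Qed.

(** The invariant of growth. Its downward closure makes guards effective: wherever a digit is
    present, so is the guard that precedes it. *)
Definition good (b : assembly) : Prop :=
  (forall x t, b x = Some t -> exists a, valid a /\ x = pos a /\ t = state_tile (st a)) /\
  (forall a a', valid a -> valid a' -> lt a' a -> b (pos a) <> None -> b (pos a') <> None) /\
  b (pos root) <> None.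

Lemma good_present b a : good b -> valid a -> b (pos a) <> None ->
  b (pos a) = Some (state_tile (st a)).
Proof.
  intros [H1 _] Ha Hn. destruct (b (pos a)) as [t|] eqn:E; [|congruence].
  destruct (H1 _ _ E) as (a' & Ha' & Hp & ->). apply pos_inj in Hp; auto. now subst.
Qed.

Lemma bond_present b a x s e : good b -> valid a -> b (pos a) <> None ->
  pos a = padd x (dvec e) ->
  bond b x s e = match face_of s e, face_of (st a) (dopp e) with
    | Lab l, Lab l' => if Nat.eqb (code l) (code l') then 1 else 0
    | Neg, Neg => -1
    | _, _ => 0
    end.
Proof.
  intros Hg Ha Hn Hp. unfold bond. rewrite <- Hp, (good_present _ _ Hg Ha Hn).
  apply interact_tile_of.
Qed.

Lemma bond_le_1 b x s e : good b -> bond b x s e <= 1.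
Proof.
  intros Hg. destruct (b (padd x (dvec e))) as [t|] eqn:E.
  - destruct (proj1 Hg _ _ E) as (a & Ha & Hp & Ht).
    rewrite (bond_present b a) by (auto; congruence).
    destruct (face_of s e), (face_of (st a) (dopp e)); try lia. destruct (_ =? _)%nat; lia.
  - unfold bond. rewrite E. lia.
Qed.

Lemma bond_pos b x s e : good b -> 0 < bond b x s e ->
  exists a l, valid a /\ b (pos a) <> None /\ pos a = padd x (dvec e) /\
    face_of s e = Lab l /\ face_of (st a) (dopp e) = Lab l.
Proof.
  intros Hg Hb. destruct (b (padd x (dvec e))) as [t|] eqn:E.
  - destruct (proj1 Hg _ _ E) as (a & Ha & Hp & Ht).
    assert (Hn : b (pos a) <> None) by congruence.
    rewrite (bond_present b a) in Hb by auto.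
    destruct (face_of s e) as [l| |] eqn:F1, (face_of (st a) (dopp e)) as [l'| |] eqn:F2; try lia.
    destruct (Nat.eqb_spec (code l) (code l')) as [C|]; [|lia].
    apply code_inj in C. subst l'. exists a, l. auto.
  - unfold bond in Hb. rewrite E in Hb. lia.
Qed.

Lemma bond_neg b x s e : good b -> bond b x s e < 0 ->
  exists a, valid a /\ b (pos a) <> None /\ pos a = padd x (dvec e) /\ face_of s e = Neg.
Proof.
  intros Hg Hb. destruct (b (padd x (dvec e))) as [t|] eqn:E.
  - destruct (proj1 Hg _ _ E) as (a & Ha & Hp & Ht).
    assert (Hn : b (pos a) <> None) by congruence.
    rewrite (bond_present b a) in Hb by auto.
    exists a. destruct (face_of s e), (face_of (st a) (dopp e)); try lia; auto.
    destruct (_ =? _)%nat; lia.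
  - unfold bond in Hb. rewrite E in Hb. lia.
Qed.

Lemma bond_ge b x s e : good b -> -1 <= bond b x s e.
Proof.
  intros Hg. destruct (b (padd x (dvec e))) as [t|] eqn:E.
  - destruct (proj1 Hg _ _ E) as (a & Ha & Hp & Ht).
    rewrite (bond_present b a) by (auto; congruence).
    destruct (face_of s e), (face_of (st a) (dopp e)); try lia. destruct (_ =? _)%nat; lia.
  - unfold bond. rewrite E. lia.
Qed.

Lemma strength_pos b x s : 1 <= nbr_strength b x (state_tile s) ->
  exists e, 0 < bond b x s e.
Proof.
  intro H. rewrite nbr_strength_bond in H. apply NNPP. intro Hn.
  assert (F : forall e, bond b x s e <= 0) by (intro e; apply Z.nlt_ge; intro; apply Hn; eauto).
  pose proof (F DN). pose proof (F DE). pose proof (F DS). pose proof (F DW). lia.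
Qed.

(** A bond is worth at most 1, so the negative one cancels whatever [e] contributes. *)
Lemma strength_guarded b x s e g : good b -> 1 <= nbr_strength b x (state_tile s) ->
  bond b x s g < 0 -> exists e', e' <> e /\ 0 < bond b x s e'.
Proof.
  intros Hg H Hn. rewrite nbr_strength_bond in H. apply NNPP. intro Hno.
  assert (F : forall e', e' <> e -> bond b x s e' <= 0)
    by (intros e' D; apply Z.nlt_ge; intro; apply Hno; eauto).
  pose proof (F DN). pose proof (F DE). pose proof (F DS). pose proof (F DW).
  pose proof (bond_le_1 b x s e Hg).
  destruct e, g;
    repeat match goal with
    | H : ?d <> ?d -> _ |- _ => clear H
    | H : _ <> _ -> _ |- _ => specialize (H ltac:(discriminate))
    end; lia.
Qed.

Lemma lt_asym a b : lt a b -> lt b a -> False.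
Proof.
  revert b. induction a as [a IH] using (well_founded_induction lt_wf).
  intros b H1 H2. now apply (IH b H2 a).
Qed.

Lemma attach_via_edge b x s e a l : good b -> b x = None -> In s states ->
  1 <= nbr_strength b x (state_tile s) ->
  valid a -> b (pos a) <> None -> pos a = padd x (dvec e) -> edge l = true ->
  face_of s e = Lab l -> face_of (st a) (dopp e) = Lab l ->
  exists z, valid z /\ x = pos z /\ s = st z /\
    forall y, valid y -> lt y z -> b (pos y) <> None.
Proof.
  intros Hg Hx Hs H1 Ha Hn Hp Hl F1 F2.
  assert (Child : forall e a l, valid a -> b (pos a) <> None -> pos a = padd x (dvec e) ->
    edge l = true -> face_of s e = Lab l -> face_of (st a) (dopp e) = Lab l ->
    exists z, valid z /\ x = pos z /\ covers a z /\ (s = st z \/ reads z s e)).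
  { clear e a l Ha Hn Hp Hl F1 F2. intros e a l Ha Hn Hp Hl F1 F2.
    assert (F1' : face_of s (dopp (dopp e)) = Lab l) by now rewrite dopp_involutive.
    destruct (edge_spec a s (dopp e) l Ha Hs Hl F2 F1') as (z & Hz & Hpz & Hc).
    rewrite Hp, padd_dopp in Hpz. rewrite dopp_involutive in Hc.
    destruct Hc as [Hc|Hc]; [exfalso; apply (proj1 (proj2 Hg) a z Ha Hz Hc Hn); congruence|].
    exists z. auto. }
  destruct (Child e a l) as (z & Hz & Hxz & Hcov & Hc); auto.
  exists z. split; [auto|]. split; [auto|]. split.
  2:{ intros y Hy Hyz. destruct (proj2 Hcov y Hy Hyz) as [->|Hlt]; auto.
      now apply (proj1 (proj2 Hg) a y). }
  destruct Hc as [Hc|(dg & g & Hdg & Hvg & Hgz & Hpg & Ng & Ns & Hr)]; [exact Hc|].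
  assert (Hgp : b (pos g) <> None).
  { destruct (proj2 Hcov g Hvg Hgz) as [->|Hlt]; auto. now apply (proj1 (proj2 Hg) a g). }
  rewrite <- Hxz in Hpg.
  assert (Hb : bond b x s dg < 0)
    by (rewrite (bond_present b g x s dg) by auto; rewrite Ng, Ns; lia).
  destruct (strength_guarded b x s e dg Hg H1 Hb) as (e' & He' & Hpos).
  destruct (bond_pos _ _ _ _ Hg Hpos) as (a' & l' & Ha' & Hn' & Hp' & G1 & G2).
  (* A second edge bond would give [z] two distinct greatest predecessors, each below the other; a
     data bond determines the state by [reads]. *)
  destruct (edge l') eqn:El'.
  - destruct (Child e' a' l') as (z' & Hz' & Hxz' & Hcov' & _); auto.
    assert (z' = z) by (apply pos_inj; congruence). subst z'.
    exfalso.
    destruct (proj2 Hcov a' Ha' (proj1 Hcov')) as [->|Q1].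
    + apply He', (padd_dir_inj x). congruence.
    + destruct (proj2 Hcov' a Ha (proj1 Hcov)) as [->|Q2]; [|now apply (lt_asym a a')].
      now apply (lt_asym a' a').
  - rewrite Hxz in Hp'. now apply (Hr e' a' l').
Qed.

(** A data bond at an empty cell never acts alone: the guard is there and cancels it, so an edge
    bond must be present as well, and [attach_via_edge] decides. *)
Lemma attach_unique b x s : good b -> b x = None -> In s states ->
  1 <= nbr_strength b x (state_tile s) ->
  exists z, valid z /\ x = pos z /\ s = st z /\
    forall y, valid y -> lt y z -> b (pos y) <> None.
Proof.
  intros Hg Hx Hs H1.
  destruct (strength_pos _ _ _ H1) as [e He].
  destruct (bond_pos _ _ _ _ Hg He) as (a & l & Ha & Hn & Hp & F1 & F2).
  destruct (edge l) eqn:El; [now apply (attach_via_edge b x s e a l)|].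
  assert (F1' : face_of s (dopp (dopp e)) = Lab l) by now rewrite dopp_involutive.
  destruct (data_spec a s (dopp e) l Ha Hs El F2 F1')
    as [(z & Hz & Hpz & Hlt)|(g & dg & Hvg & Hlt & Hpg & Ng & Ns & Hd)].
  { rewrite Hp, padd_dopp in Hpz. exfalso.
    apply (proj1 (proj2 Hg) a z Ha Hz Hlt Hn). congruence. }
  rewrite Hp, padd_dopp in Hpg.
  assert (Hb : bond b x s dg < 0).
  { rewrite (bond_present b g x s dg); auto.
    - rewrite Ng, Ns. lia.
    - now apply (proj1 (proj2 Hg) a g). }
  destruct (strength_guarded b x s e dg Hg H1 Hb) as (e' & He' & Hpos).
  destruct (bond_pos _ _ _ _ Hg Hpos) as (a' & l' & Ha' & Hn' & Hp' & G1 & G2).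
  destruct (edge l') eqn:El'; [now apply (attach_via_edge b x s e' a' l')|].
  exfalso. apply He'. rewrite <- (dopp_involutive e). now apply (Hd e' l').
Qed.

Lemma good_step b c : good b -> step tile_set 1 b c -> good c.
Proof.
  intros Hg (x & t & (Hin & Hx & H1) & Hcx & Ho).
  unfold tile_set in Hin. apply nodup_In in Hin. apply in_map_iff in Hin as (s & <- & Hs).
  destruct (attach_unique b x s Hg Hx Hs H1) as (z & Hz & -> & -> & Hlow).
  assert (Hmono : forall y, b y <> None -> c y <> None).
  { intros y Hy. rewrite Ho; auto. congruence. }
  destruct Hg as (G1 & G2 & G3). split; [|split]; auto.
  - intros y t Hy. destruct (classic (y = pos z)) as [->|D].
    + exists z. repeat split; auto; congruence.
    + rewrite Ho in Hy by auto. auto.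
  - intros a a' Ha Ha' Hlt Hc. destruct (classic (pos a = pos z)) as [E|D].
    + apply pos_inj in E; auto. subst a. auto.
    + rewrite Ho in Hc by auto. apply Hmono. now apply (G2 a a').
Qed.

Lemma good_seed : good (single_seed (state_tile (st root)) (pos root)).
Proof.
  assert (E : single_seed (state_tile (st root)) (pos root) (pos root)
              = Some (state_tile (st root))) by (unfold single_seed; now rewrite !Z.eqb_refl).
  assert (D : forall x t, single_seed (state_tile (st root)) (pos root) x = Some t -> x = pos root).
  { intros x t. unfold single_seed.
    destruct (Z.eqb_spec (fst x) (fst (pos root))), (Z.eqb_spec (snd x) (snd (pos root)));
      simpl; try discriminate.
    intros _. destruct x, (pos root); simpl in *; congruence. }
  split; [|split].
  - intros x t H. exists root. pose proof (D _ _ H). subst x.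
    split; [auto|]. split; [auto|]. congruence.
  - intros a a' Ha Ha' Hlt Hn. exfalso.
    destruct (single_seed _ _ (pos a)) eqn:Q; [|congruence].
    apply D, pos_inj in Q; auto. subst a. now apply (root_min a').
  - congruence.
Qed.

(** Once all cells below [a] are filled, its parent supplies a bond. A negative side of [a] either
    faces a later cell, which cannot be filled while [a] is empty, or is outweighed by the data
    bond. *)
Lemma good_terminal b : good b -> terminal tile_set 1 b ->
  forall a, valid a -> b (pos a) = Some (state_tile (st a)).
Proof.
  intros Hg Ht a. induction a as [a IH] using (well_founded_induction lt_wf). intro Ha.
  apply good_present; auto. intro Hnone.
  destruct (classic (a = root)) as [->|Hr]; [now apply (proj2 (proj2 Hg))|].
  assert (Hlow : forall y, valid y -> lt y a -> b (pos y) <> None)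
    by (intros y Hy Hlt; rewrite (IH y) by auto; discriminate).
  apply (Ht (pos a) (state_tile (st a))). split; [|split]; auto.
  { unfold tile_set. apply nodup_In, in_map; auto. }
  destruct (parent_spec a Ha Hr) as (p & d & l & Hp & Hc & Hpos & He & F1 & F2).
  apply padd_dopp_swap in Hpos.
  assert (B1 : bond b (pos a) (st a) (dopp d) = 1).
  { rewrite (bond_present b p); auto.
    - rewrite F2, dopp_involutive, F1, Nat.eqb_refl. reflexivity.
    - apply Hlow; auto. apply Hc. }
  rewrite nbr_strength_bond.
  destruct (neg_spec a Ha Hr) as [Hneg|(dg & dd & q & l' & Hn & Hq & Hlt & Hpq & El & G1 & G2)].
  - assert (F : forall e, 0 <= bond b (pos a) (st a) e).
    { intro e. apply Z.nlt_ge. intro Hb.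
      destruct (bond_neg _ _ _ _ Hg Hb) as (r & Hvr & Hnr & Hpr & Nr).
      destruct (Hneg e Nr) as (r' & Hvr' & Hpr' & Hlt).
      apply (proj1 (proj2 Hg) r' a); auto; congruence. }
    pose proof (F DN). pose proof (F DE). pose proof (F DS). pose proof (F DW).
    destruct d; simpl in B1; lia.
  - assert (B2 : bond b (pos a) (st a) dd = 1).
    { rewrite (bond_present b q); auto.
      rewrite G1, G2, Nat.eqb_refl. reflexivity. }
    assert (Hne : dopp d <> dd) by congruence.
    assert (F : forall e, e <> dg -> 0 <= bond b (pos a) (st a) e).
    { intros e D. apply Z.nlt_ge. intro Hb.
      destruct (bond_neg _ _ _ _ Hg Hb) as (r & _ & _ & _ & Nr). now apply D, Hn. }
    pose proof (F DN). pose proof (F DE). pose proof (F DS). pose proof (F DW).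
    pose proof (bond_ge b (pos a) (st a) dg Hg).
    destruct d, dd, dg; simpl in B1, Hne; try congruence;
      repeat match goal with
      | H : ?d <> ?d -> _ |- _ => clear H
      | H : _ <> _ -> _ |- _ => specialize (H ltac:(discriminate))
      end; lia.
Qed.

Lemma tile_set_restricted s0 d0 : In s0 states -> face_of s0 d0 = Neg ->
  glue_restricted tile_set.
Proof.
  intros Hs0 Hd0.
  assert (Tile : forall t, In t tile_set -> exists s, In s states /\ t = state_tile s).
  { intros t Ht. unfold tile_set in Ht. apply nodup_In, in_map_iff in Ht as (s & <- & Hs). eauto. }
  split.
  - intros t d Ht. destruct (Tile t Ht) as (s & _ & ->). unfold state_tile.
    rewrite tglue_tile_of. now destruct (face_of s d).
  - exists O. split.
    + exists (state_tile s0), d0. split.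
      * unfold tile_set. now apply nodup_In, in_map.
      * unfold state_tile. now rewrite tglue_tile_of, Hd0.
    + intros t d Ht. destruct (Tile t Ht) as (s & _ & ->). unfold state_tile.
      rewrite tglue_tile_of. destruct (face_of s d); simpl; auto; lia.
Qed.

Lemma tile_set_length : (length tile_set <= length states)%nat.
Proof.
  unfold tile_set. rewrite <- (length_map state_tile states).
  apply NoDup_incl_length; [apply NoDup_nodup|]. intros t Ht. now apply nodup_In in Ht.
Qed.

Lemma root_in_tile_set : In (state_tile (st root)) tile_set.
Proof. unfold tile_set. apply nodup_In, in_map; auto. Qed.

Theorem growth_theorem (X : zpos -> Prop) (cells : list zpos) :
  (forall x, X x <-> exists a, valid a /\ pos a = x) ->
  (forall x, X x -> In x cells) ->
  directed tile_set 1 (single_seed (state_tile (st root)) (pos root)) /\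
  strictly_self_assembles tile_set 1 (single_seed (state_tile (st root)) (pos root)) X.
Proof.
  intros HX Hcells. set (sigma := single_seed _ _).
  assert (Hterm : forall b, terminal_assembly tile_set 1 sigma b ->
    good b /\ forall a, valid a -> b (pos a) = Some (state_tile (st a))).
  { intros b [(s & Hs & Hres) Ht].
    assert (Hgs : forall n, good (s n)).
    { destruct Hs as [H0 Hs]. induction n as [|n IH].
      - replace (s O) with sigma; [apply good_seed|].
        apply functional_extensionality. intro x. now rewrite (H0 x).
      - destruct (Hs n) as [E|E]; [|now apply (good_step (s n))].
        replace (s (Datatypes.S n)) with (s n); auto.
        apply functional_extensionality. intro x. now rewrite E. }
    assert (Hup : forall n x, s n x <> None -> b x <> None).
    { intros n x Hn. destruct (s n x) as [t|] eqn:E; [|congruence].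
      assert (b x = Some t) by (apply Hres; eauto). congruence. }
    (* The invariant survives the limit of an infinite sequence because each cell is filled at a
       finite stage. *)
    assert (Hg : good b).
    { split; [|split].
      - intros x t Hx. apply Hres in Hx as [n Hn]. now apply (Hgs n).
      - intros a a' Ha Ha' Hlt Hn. destruct (b (pos a)) as [t|] eqn:E; [|congruence].
        apply Hres in E as [n E]. apply (Hup n).
        apply (proj1 (proj2 (Hgs n)) a a'); auto; congruence.
      - apply (Hup O), Hgs. }
    split; [exact Hg|]. now apply good_terminal. }
  assert (Huniq : forall b c, terminal_assembly tile_set 1 sigma b ->
    terminal_assembly tile_set 1 sigma c -> aeq b c).
  { intros b c Hb Hc x. destruct (Hterm b Hb) as [Gb Pb], (Hterm c Hc) as [Gc Pc].
    destruct (b x) as [t|] eqn:E.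
    - destruct (proj1 Gb _ _ E) as (a & Ha & -> & ->). now rewrite Pc.
    - destruct (c x) as [t|] eqn:E'; [|reflexivity].
      destruct (proj1 Gc _ _ E') as (a & Ha & -> & ->). rewrite Pb in E by auto. discriminate. }
  split.
  - destruct (reach_terminal tile_set sigma cells) as (b & Hb & Ht).
    { intros b Hb. assert (Hg : good b).
      { induction Hb; [apply good_seed|eapply good_step; eauto]. }
      intros x Hx. destruct (b x) as [t|] eqn:E; [|congruence].
      destruct (proj1 Hg _ _ E) as (a & Ha & -> & _). apply Hcells, HX. eauto. }
    assert (Hb' : terminal_assembly tile_set 1 sigma b)
      by (split; [now apply reach_producible|exact Ht]).
    exists b. split; auto.
  - intros b Hb x. destruct (Hterm b Hb) as [Gb Pb]. rewrite HX. split.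
    + intro Hx. destruct (b x) as [t|] eqn:E; [|congruence].
      destruct (proj1 Gb _ _ E) as (a & Ha & -> & _). eauto.
    + intros (a & Ha & <-). rewrite Pb by auto. discriminate.
Qed.

End Growth.

(** * The pinwheel of counters *)

Definition zrange (a n : Z) : list Z := map (fun i => a + Z.of_nat i) (seq 0 (Z.to_nat n)).

Lemma zrange_in a n x : In x (zrange a n) <-> a <= x < a + n.
Proof.
  unfold zrange. rewrite in_map_iff. split.
  - intros (i & <- & Hi). apply in_seq in Hi. lia.
  - intro Hx. exists (Z.to_nat (x - a)). split; [lia|]. apply in_seq. lia.
Qed.

Lemma zrange_length a n : length (zrange a n) = Z.to_nat n.
Proof. unfold zrange. now rewrite length_map, length_seq. Qed.

#[local] Arguments Z.mul : simpl never.
#[local] Arguments Z.add : simpl never.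
#[local] Arguments Z.sub : simpl never.
#[local] Arguments Z.opp : simpl never.
#[local] Arguments Z.div : simpl never.
#[local] Arguments Z.modulo : simpl never.
#[local] Arguments Z.even : simpl never.
#[local] Arguments Z.eqb : simpl never.
#[local] Arguments Z.ltb : simpl never.
#[local] Arguments Z.pow : simpl never.

(** * Integer lists as glue labels *)

Definition zcode (z : Z) : nat :=
  match z with Z0 => 0 | Zpos p => 2 * Pos.to_nat p | Zneg p => 2 * Pos.to_nat p + 1 end%nat.

Lemma zcode_inj x y : zcode x = zcode y -> x = y.
Proof. destruct x, y; simpl; intro; try lia; f_equal; lia. Qed.

Fixpoint lcode (l : list Z) : nat :=
  match l with [] => O | z :: l' => S (Cantor.to_nat (zcode z, lcode l')) end.

Lemma lcode_inj l l' : lcode l = lcode l' -> l = l'.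
Proof.
  revert l'. induction l as [|z l IH]; intros [|z' l'] E; try discriminate; [reflexivity|].
  cbn [lcode] in E. apply Nat.succ_inj, Cantor.to_nat_inj in E. injection E as E1 E2.
  f_equal; auto using zcode_inj.
Qed.

(** * States, labels and addresses *)

Inductive strip := S0 | S1 | S2 | S3.
(* The cells that a pass visits for one digit, and those of the turn at its end, in the order of
   the path: U0 enters the pit, U1 reads the digit below, U4 guards the pit of the next pass,
   U6 writes the new digit at its bottom, and U7 leaves. *)
Inductive body_cell := U0 | U1 | U2 | U3 | U4 | U5 | U6 | U7.
Inductive turn_cell := T0 | T1 | T2 | T3 | T4 | T5 | T6 | T7.

Definition cw (d : dir) : dir :=
  match d with DN => DE | DE => DS | DS => DW | DW => DN end.

Definition rotd (s : strip) (d : dir) : dir :=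
  match s with S0 => d | S1 => cw d | S2 => dopp d | S3 => dopp (cw d) end.

Definition mirror (p : bool) (d : dir) : dir :=
  if p then match d with DE => DW | DW => DE | _ => d end else d.

Definition tdir (s : strip) (p : bool) (d : dir) : dir := rotd s (mirror p d).

Definition itdir (s : strip) (p : bool) (d : dir) : dir :=
  mirror p (rotd (match s with S1 => S3 | S3 => S1 | _ => s end) d).

Lemma itdir_tdir s p d : itdir s p (tdir s p d) = d.
Proof. now destruct s, p, d. Qed.

Lemma tdir_itdir s p d : tdir s p (itdir s p d) = d.
Proof. now destruct s, p, d. Qed.

Lemma tdir_dopp s p d : tdir s p (dopp d) = dopp (tdir s p d).
Proof. now destruct s, p, d. Qed.

(* [p] is true in the passes that run from right to left, [q] is the carry (in a right-to-left
   pass: the overflow flag), [d] the digit, and [bl], [br] tell whether it is the leftmost or the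
   rightmost one.  In [Body] at U1 these are the values read, elsewhere the values to be written.
   [v] tells whether the entry cell is reached from above, [l] whether the digit is the last one of
   its pass.  All directions are relative to the pass, which always runs east. *)
Inductive state :=
| Seed (s : strip) (x y : Z)
| Entry (s : strip) (p q v : bool)
| Body (s : strip) (p : bool) (u : body_cell) (q : bool) (d : Z) (bl br : bool)
| Exit (s : strip) (p q l : bool)
| Turn (s : strip) (p : bool) (u : turn_cell) (q : bool)
| Trunk
| Row.

Inductive label :=
| Bond (a : state)
| Digit (s : strip) (p : bool) (d : Z) (bl br : bool).

Definition is_edge (l : label) : bool := match l with Bond _ => true | _ => false end.

Inductive address :=
| ASeed (s : strip) (x y : Z)
| ACell (s : strip) (j c : Z) (u : body_cell)
| ATurn (s : strip) (j : Z) (u : turn_cell)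
| AFill (x y : Z).

Definition state_strip (a : state) : strip :=
  match a with
  | Seed s _ _ | Entry s _ _ _ | Body s _ _ _ _ _ _ | Exit s _ _ _ | Turn s _ _ _ => s
  | Trunk | Row => S0
  end.

(** The first row plays the part of pass 0 and, like every even pass, runs from right to left. For
    the fill, strip [S0] and parity [false] make relative directions absolute. *)
Definition state_par (a : state) : bool :=
  match a with
  | Seed _ _ _ => true
  | Entry _ p _ _ | Body _ p _ _ _ _ _ | Exit _ p _ _ | Turn _ p _ _ => p
  | Trunk | Row => false
  end.

(* What the predecessor of a cell knows of its state: a reader finds out the digit by itself. *)
Definition norm (a : state) : state :=
  match a with Body s p U1 q _ _ _ => Body s p U1 q 0 false false | _ => a end.

Definition next_strip (s : strip) : option strip :=
  match s with S0 => Some S1 | S1 => Some S2 | S2 => Some S3 | S3 => None end.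

Definition rk (s : strip) : Z := match s with S0 => 0 | S1 => 1 | S2 => 2 | S3 => 3 end.
Definition rku (u : body_cell) : Z :=
  match u with U0 => 0 | U1 => 1 | U2 => 2 | U3 => 3 | U4 => 4 | U5 => 5 | U6 => 6 | U7 => 7 end.
Definition rkt (u : turn_cell) : Z :=
  match u with T0 => 0 | T1 => 1 | T2 => 2 | T3 => 3 | T4 => 4 | T5 => 5 | T6 => 6 | T7 => 7 end.

(* Height of column [x] of the hard-coded first row. *)
Definition top (x : Z) : Z := if x <? 2 then -1 else if x mod 4 <? 2 then 0 else 1.

Lemma top_cases x : (x < 2 /\ top x = -1) \/ (2 <= x /\ x mod 4 < 2 /\ top x = 0) \/
  (2 <= x /\ 2 <= x mod 4 /\ top x = 1).
Proof. unfold top. destruct (Z.ltb_spec x 2), (Z.ltb_spec (x mod 4) 2); lia. Qed.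

Definition only (c : bool) (a : state) : option state := if c then Some a else None.

Ltac zmod := Z.to_euclidean_division_equations; lia.

Section Pinwheel.

(* A strip makes [m] increments; the hard-coded first row reaches [depth] levels below 0, which
   adjusts the length of the strip modulo 4. *)
Variables k b m depth : Z.
Hypothesis k_pos : 1 <= k.
Hypothesis b_ge2 : 2 <= b.
Hypothesis m_pos : 1 <= m.
Hypothesis m_le : m <= b ^ k.
Hypothesis depth_pos : 1 <= depth.
Hypothesis thin : 4 * k + 3 < 4 * m + 1 + depth.

Let J := 2 * m.
Let w := 4 * k + 3.
Let H := 4 * m + 1 + depth.
Let N := H + w.
(* The overflow occurs after exactly [m] increments. *)
Let V0 := b ^ k - m.

(** * The counter and its local rules *)

Definition digit (v i : Z) : Z := (v / b ^ i) mod b.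
Definition value (j : Z) : Z := V0 + (j + 1) / 2.
(** In an incrementing pass the carry is expressed through the result: it reaches digit [c] exactly
    if the [c] lower digits of the new value vanish. In a copying pass it is the overflow flag. *)
Definition carry (j c : Z) : bool :=
  if Z.even j then j =? J else (value j) mod b ^ c =? 0.
Definition digit_index (j c : Z) : Z := if Z.even j then k - 1 - c else c.

Definition advance (p q : bool) (d : Z) : bool * Z :=
  if p then (q, d) else if q then (if d =? b - 1 then (true, 0) else (false, d + 1)) else (false, d).

(** The first row is a serpentine: even columns are climbed and odd ones descended, and columns
    [2 h] and [2 h + 1] are joined at their common top. At [U5], [p && q] marks the last pass, which
    omits [U3] and [U4] so that the strip ends in a straight edge. *)
Definition in_dir (a : state) : dir :=
  match a with
  | Seed _ x y => if Z.even x then (if y =? - depth then DW else DS)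
                else (if y =? top x then DW else DN)
  | Entry _ _ _ v => if v then DN else DW
  | Body _ p u q _ _ _ =>
      match u with U2 | U3 => DS | U5 => if p && q then DW else DN | _ => DW end
  | Exit _ _ _ _ => DW
  | Turn _ _ u _ => match u with T0 | T1 => DN | T2 => DW | T7 => DE | _ => DS end
  | Trunk => DS
  | Row => DW
  end.

(** [T5] hands on [p] as the next carry: after a copy the next pass starts with carry 1, after an
    increment without overflow the flag stays off. An overflow takes the detour through [T6] and
    [T7], enters the last pass from above and sets the flag. *)
Definition out_state (a : state) (e : dir) : option state :=
  match a, e with
  | Seed s x y, DN => only (Z.even x && (y <? top x)) (Seed s x (y + 1))
  | Seed s x y, DE =>
      only (if Z.even x then (y =? top x) && negb (x =? 4 * k + 2) else y =? - depth) (Seed s (x + 1) y)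
  | Seed s x y, DS => only (negb (Z.even x) && negb (y =? - depth)) (Seed s x (y - 1))
  | Seed s x y, DW => only ((x =? 4 * k + 2) && (y =? 1)) (Entry s false true false)
  | Entry s p q _, DE => Some (Body s p U1 q 0 false false)
  | Body s p U1 q d bl br, DN => let (q', d') := advance p q d in Some (Body s p U2 q' d' bl br)
  | Body s p U2 q d bl br, DN => only (negb (p && q)) (Body s p U3 q d bl br)
  | Body s p U2 q d bl br, DE => only (p && q) (Body s p U5 q d bl br)
  | Body s p U3 q d bl br, DE => Some (Body s p U4 q d bl br)
  | Body s p U4 q d bl br, DS => only (negb (p && q)) (Body s p U5 q d bl br)
  | Body s p U5 q d bl br, DE => Some (Body s p U6 q d bl br)
  | Body s p U6 q d bl br, DE => Some (Exit s p q (if p then bl else br))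
  | Exit s p q l, DS => Some (if l then Turn s p T0 q else Entry s p q true)
  | Turn s p T0 q, DS => Some (Turn s p T1 q)
  | Turn s p T1 q, DE => Some (Turn s p T2 q)
  | Turn s p T2 q, DN => Some (Turn s p T3 q)
  | Turn s p T3 q, DN => Some (Turn s p T4 q)
  | Turn s p T4 q, DN =>
      if p && q then match next_strip s with Some s' => Some (Seed s' 0 (- depth)) | None => None end
      else Some (Turn s p T5 q)
  | Turn s p T5 q, DN => only q (Turn s p T6 q)
  | Turn s p T5 q, DW => only (negb q) (Entry s (negb p) p false)
  | Turn s p T6 q, DW => Some (Turn s p T7 q)
  | Turn S3 false T6 q, DE => Some Trunk
  | Turn s p T7 q, DS => Some (Entry s (negb p) true true)
  | Trunk, DN => Some Trunk
  | Trunk, DE => Some Row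
  | Row, DE => Some Row
  | _, _ => None
  end.

(** Reader and guard both show the negative glue, since only equal glues interact. *)
Definition neg_on (a : state) (e : dir) : bool :=
  match a, e with
  | Seed _ x y, DE => (x mod 4 =? 3) && (y =? 1)
  | Body _ _ U1 _ _ _ _, DE | Body _ _ U4 _ _ _ _, DE => true
  | _, _ => false
  end.

(** The parity in the label is that of the reading pass, hence [negb p] at the writer. The first row
    is mirrored, so its column [4 h] carries digit [k - h]. *)
Definition data_on (a : state) (e : dir) : option label :=
  match a, e with
  | Seed s x y, DN =>
      if (x mod 4 =? 0) && (0 <? x) && (y =? 0)
      then Some (Digit s false (digit V0 (k - x / 4)) (k - x / 4 =? 0) (k - x / 4 =? k - 1)) else None
  | Body s p U1 q d bl br, DS => Some (Digit s p d bl br)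
  | Body s p U6 q d bl br, DN => if p && q then None else Some (Digit s (negb p) d bl br)
  | _, _ => None
  end.

Definition cface (a : state) (e : dir) : face label :=
  if dir_eq_dec e (in_dir a) then Lab (Bond (norm a)) else
  match out_state a e with
  | Some a' => Lab (Bond a')
  | None => if neg_on a e then Neg else match data_on a e with Some l => Lab l | None => Null end
  end.

Definition face_of (a : state) (d : dir) : face label :=
  cface a (itdir (state_strip a) (state_par a) d).

(** * Cells, positions and parents *)

Definition valid (a : address) : Prop :=
  match a with
  | ASeed _ x y => 0 <= x <= 4 * k + 2 /\ - depth <= y <= top x
  | ACell _ j c u => 1 <= j <= J /\ 0 <= c < k /\ (j = J -> u <> U3 /\ u <> U4)
  | ATurn _ j u => 1 <= j <= J /\ (u = T6 \/ u = T7 -> j = J - 1) /\ (u = T5 -> j < J)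
  | AFill x y => w <= x < H /\ w <= y < H
  end.

Definition adr_strip (a : address) : strip :=
  match a with ASeed s _ _ | ACell s _ _ _ | ATurn s _ _ => s | AFill _ _ => S0 end.

Definition adr_par (a : address) : bool :=
  match a with ASeed _ _ _ => true | ACell _ j _ _ | ATurn _ j _ => Z.even j | AFill _ _ => false end.

Definition st (a : address) : state :=
  match a with
  | ASeed s x y => Seed s x y
  | ACell s j c U0 => Entry s (Z.even j) (carry j c) ((0 <? c) || (j =? J))
  | ACell s j c U1 => Body s (Z.even j) U1 (carry j c) (digit (value (j - 1)) (digit_index j c))
                      (digit_index j c =? 0) (digit_index j c =? k - 1)
  | ACell s j c U7 => Exit s (Z.even j) (carry j (c + 1)) (c =? k - 1)
  | ACell s j c u => Body s (Z.even j) u (carry j (c + 1)) (digit (value j) (digit_index j c))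
                      (digit_index j c =? 0) (digit_index j c =? k - 1)
  | ATurn s j u => Turn s (Z.even j) u (carry j k)
  | AFill x y => if x =? w then Trunk else Row
  end.

Lemma st_strip a : state_strip (st a) = adr_strip a.
Proof. destruct a as [| ? ? ? []| |]; simpl; try destruct (_ =? _); reflexivity. Qed.

Lemma st_par a : state_par (st a) = adr_par a.
Proof. destruct a as [| ? ? ? []| |]; simpl; try destruct (_ =? _); reflexivity. Qed.

(* Coordinates of a cell in the direction of its pass; [frame] undoes the mirroring of the
   right-to-left passes, [rotp] turns the strip into place. *)
Definition cpos (a : address) : zpos :=
  match a with
  | ASeed _ x y => (x, y)
  | ACell _ j c u =>
      match u with
      | U0 => (4 * c + 1, 2 * j - 1)
      | U1 => (4 * c + 2, 2 * j - 1)
      | U2 => (4 * c + 2, 2 * j)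
      | U3 => (4 * c + 2, 2 * j + 1)
      | U4 => (4 * c + 3, 2 * j + 1)
      | U5 => (4 * c + 3, 2 * j)
      | U6 => (4 * c + 4, 2 * j)
      | U7 => (4 * c + 5, 2 * j)
      end
  | ATurn _ j u =>
      match u with
      | T0 => (4 * k + 1, 2 * j - 1)
      | T1 => (4 * k + 1, 2 * j - 2)
      | T2 => (4 * k + 2, 2 * j - 2)
      | T3 => (4 * k + 2, 2 * j - 1)
      | T4 => (4 * k + 2, 2 * j)
      | T5 => (4 * k + 2, 2 * j + 1)
      | T6 => (4 * k + 2, 2 * j + 2)
      | T7 => (4 * k + 1, 2 * j + 2)
      end
  | AFill x y => (x, y - depth)
  end.

Definition rotp (s : strip) (x : zpos) : zpos :=
  match s with
  | S0 => x
  | S1 => (snd x, N - 1 - fst x)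
  | S2 => (N - 1 - fst x, N - 1 - snd x)
  | S3 => (N - 1 - snd x, fst x)
  end.

Definition frame (p : bool) (x : zpos) : zpos :=
  ((if p then 4 * k + 2 - fst x else fst x), snd x + depth).

Definition pos (a : address) : zpos := rotp (adr_strip a) (frame (adr_par a) (cpos a)).

Lemma pos_step s p x e :
  rotp s (frame p (padd x (dvec e))) = padd (rotp s (frame p x)) (dvec (tdir s p e)).
Proof.
  destruct x as [x y], s, p, e; unfold frame, padd; simpl; f_equal; lia.
Qed.

Lemma frame_flip p x y : frame (negb p) (x, y) = frame p (4 * k + 2 - x, y).
Proof. destruct p; unfold frame; simpl; f_equal; lia. Qed.

(* The fill is attached to the turn cell T6 of the last strip. *)
Definition key (a : address) : Z * Z * Z * Z :=
  match a with
  | ASeed s x y => (rk s, 0, x, if Z.even x then y else - y)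
  | ACell s j c u => (rk s, j, c, rku u)
  | ATurn s j u => (rk s, j, k, rkt u)
  | AFill _ _ => (3, J - 1, k, 6)
  end.

Definition lexlt (x y : Z * Z * Z * Z) : Prop :=
  let '(x1, x2, x3, x4) := x in let '(y1, y2, y3, y4) := y in
  x1 < y1 \/ (x1 = y1 /\ (x2 < y2 \/ (x2 = y2 /\ (x3 < y3 \/ (x3 = y3 /\ x4 < y4))))).

(** The fill comes after the path up to the cell [T6] from which the trunk starts, and is
    incomparable with the rest of the last strip. Inside the fill the order is that of a comb: along
    each row, and from a trunk cell to all higher rows. *)
Definition lt (a a' : address) : Prop :=
  valid a /\ valid a' /\
  match a, a' with
  | AFill x y, AFill x' y' => (y = y' /\ x < x') \/ (x = w /\ y < y')
  | AFill _ _, _ => False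
  | _, AFill _ _ => lexlt (key a) (key a') \/ key a = key a'
  | _, _ => lexlt (key a) (key a')
  end.

Definition prev_strip (s : strip) : strip :=
  match s with S0 | S1 => S0 | S2 => S1 | S3 => S2 end.

Definition parent (a : address) : address :=
  match a with
  | ASeed s x y =>
      if Z.even x then
        if y =? - depth then (if x =? 0 then ATurn (prev_strip s) J T4 else ASeed s (x - 1) y)
        else ASeed s x (y - 1)
      else if y =? top x then ASeed s (x - 1) y else ASeed s x (y + 1)
  | ACell s j c U0 =>
      if c =? 0 then
        if j =? 1 then ASeed s (4 * k + 2) 1 else ATurn s (j - 1) (if j =? J then T7 else T5)
      else ACell s j (c - 1) U7
  | ACell s j c U1 => ACell s j c U0
  | ACell s j c U2 => ACell s j c U1
  | ACell s j c U3 => ACell s j c U2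
  | ACell s j c U4 => ACell s j c U3
  | ACell s j c U5 => ACell s j c (if j =? J then U2 else U4)
  | ACell s j c U6 => ACell s j c U5
  | ACell s j c U7 => ACell s j c U6
  | ATurn s j T0 => ACell s j (k - 1) U7
  | ATurn s j T1 => ATurn s j T0
  | ATurn s j T2 => ATurn s j T1
  | ATurn s j T3 => ATurn s j T2
  | ATurn s j T4 => ATurn s j T3
  | ATurn s j T5 => ATurn s j T4
  | ATurn s j T6 => ATurn s j T5
  | ATurn s j T7 => ATurn s j T6
  | AFill x y =>
      if x =? w then (if y =? w then ATurn S3 (J - 1) T6 else AFill x (y - 1)) else AFill (x - 1) y
  end.

(** Relative to the pass of the parent, which differs from that of [a] where a new pass or strip
    begins. *)
Definition parent_dir (a : address) : dir :=
  match a with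
  | ASeed s x y =>
      if Z.even x then (if y =? - depth then (if x =? 0 then DN else DE) else DN)
      else if y =? top x then DE else DS
  | ACell s j c U0 => if c =? 0 then (if j =? 1 then DW else if j =? J then DS else DW) else DS
  | ACell s j c U1 => DE
  | ACell s j c U2 => DN
  | ACell s j c U3 => DN
  | ACell s j c U4 => DE
  | ACell s j c U5 => if j =? J then DE else DS
  | ACell s j c U6 => DE
  | ACell s j c U7 => DE
  | ATurn s j T0 => DS
  | ATurn s j T1 => DS
  | ATurn s j T2 => DE
  | ATurn s j T7 => DW
  | ATurn s j _ => DN
  | AFill x y => if x =? w then (if y =? w then DE else DN) else DE
  end.

Definition root : address := ASeed S0 0 (- depth).

Lemma even_spec x : (Z.even x = true /\ x mod 2 = 0) \/ (Z.even x = false /\ x mod 2 = 1).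
Proof.
  rewrite Zeven_mod. pose proof (Z.mod_pos_bound x 2).
  destruct (Z.eqb_spec (x mod 2) 0); [left|right]; split; auto; lia.
Qed.

Ltac tcase x := destruct (top_cases x) as [[? ?]|[(? & ? & ?)|(? & ? & ?)]].
Ltac evcase x := destruct (even_spec x) as [[?E ?]|[?E ?]].

Lemma top_next x : 0 <= x <= 4 * k -> Z.even x = true -> top (x + 1) = top x.
Proof. intros Hx E. evcase x; [|congruence]. tcase x; tcase (x + 1); zmod. Qed.

Lemma top_last : top (4 * k + 2) = 1.
Proof. tcase (4 * k + 2); zmod. Qed.

Ltac vsolve :=
  repeat match goal with
  | |- _ /\ _ => split
  | |- _ -> _ => intro
  | |- _ <> _ => intro
  | H : _ \/ _ |- _ => destruct H
  | H : _ /\ _ |- _ => destruct H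
  | H : ?P -> _ /\ _, H0 : ?P |- _ => specialize (H H0)
  | H : ?u = ?u -> _ |- _ => specialize (H eq_refl)
  | H : ?u = ?u \/ _ -> _ |- _ => specialize (H (or_introl eq_refl))
  | H : _ \/ ?u = ?u -> _ |- _ => specialize (H (or_intror eq_refl))
  end; try discriminate; try congruence; try lia.

Lemma size_defs : J = 2 * m /\ w = 4 * k + 3 /\ H = 4 * m + 1 + depth /\ N = H + w.
Proof. now unfold J, w, H, N. Qed.

Ltac sizes := destruct size_defs as (HJ & Hw & HH & HN).

Lemma par_valid a : valid a -> a <> root -> valid (parent a).
Proof.
  sizes.
  intros Ha Hr. destruct a as [s x y|s j c u|s j u|x y]; simpl in *.
  - destruct Ha as [Hx Hy]. evcase x; rewrite E.
    + destruct (Z.eqb_spec y (- depth)); [destruct (Z.eqb_spec x 0)|]; simpl; vsolve.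
      subst y. tcase (x - 1); lia.
    + destruct (Z.eqb_spec y (top x)); simpl; [|lia].
      assert (Hp : top x = top (x - 1)).
      { replace x with (x - 1 + 1) at 1 by lia. apply top_next; [zmod|].
        evcase (x - 1); auto. zmod. }
      zmod.
  - destruct u; simpl.
    { destruct (Z.eqb_spec c 0); [destruct (Z.eqb_spec j 1)|]; simpl.
      - rewrite top_last. lia.
      - destruct (Z.eqb_spec j J); simpl; vsolve.
      - vsolve. }
    5: destruct (Z.eqb_spec j J); simpl.
    all: vsolve.
  - destruct u; simpl; vsolve.
  - destruct (Z.eqb_spec x w); [destruct (Z.eqb_spec y w)|]; simpl; vsolve.
Qed.

Lemma par_pos a : valid a -> a <> root ->
  pos a = padd (pos (parent a)) (dvec (tdir (adr_strip (parent a)) (adr_par (parent a)) (parent_dir a))).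
Proof.
  sizes. intros Ha Hr.
  (* A step into the next pass: the frames are mirror images, which the coordinate [4 * k + 2 - x]
     absorbs. *)
  assert (Flip : forall s j x y x' y' e,
    padd (x', y') (dvec e) = (4 * k + 2 - x, y) ->
    rotp s (frame (Z.even j) (x, y)) =
    padd (rotp s (frame (Z.even (j - 1)) (x', y'))) (dvec (tdir s (Z.even (j - 1)) e))).
  { intros s j x y x' y' e He.
    replace (Z.even j) with (negb (Z.even (j - 1))) by
      (rewrite Z.even_sub; now destruct (Z.even j)).
    rewrite frame_flip, <- He. apply pos_step. }
  assert (Same : forall s p x x' e, padd x' (dvec e) = x ->
    rotp s (frame p x) = padd (rotp s (frame p x')) (dvec (tdir s p e))).
  { intros s p x x' e <-. apply pos_step. }
  unfold pos. destruct a as [s x y|s j c u|s j u|x y]; simpl in *.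
  - evcase x; rewrite E.
    + destruct (Z.eqb_spec y (- depth)); [destruct (Z.eqb_spec x 0)|]; simpl.
      * assert (HE : Z.even J = true) by (rewrite HJ; now rewrite Z.even_mul).
        rewrite HE. subst x y.
        (* The strips fit together here: since [N = H + w], the last cell of a strip adjoins the
           first cell of the next one. *)
        destruct s; [now elim Hr| | |]; unfold frame, padd; simpl; f_equal; lia.
      * apply Same. unfold padd; simpl; f_equal; lia.
      * apply Same. unfold padd; simpl; f_equal; lia.
    + destruct (Z.eqb_spec y (top x)); simpl; apply Same; unfold padd; simpl; f_equal; lia.
  - destruct u.
    { destruct (Z.eqb_spec c 0); [destruct (Z.eqb_spec j 1)|]; simpl.
      - subst. apply (Flip s 1). unfold padd; simpl; f_equal; lia.
      - destruct (Z.eqb_spec j J); simpl; apply Flip; unfold padd; simpl; f_equal; lia.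
      - apply Same. unfold padd; simpl; f_equal; lia. }
    5: destruct (Z.eqb_spec j J).
    all: apply Same; unfold padd; simpl; f_equal; lia.
  - destruct u; apply Same; unfold padd; simpl; f_equal; lia.
  - destruct (Z.eqb_spec x w); [destruct (Z.eqb_spec y w)|].
    + assert (HE : Z.even (J - 1) = false) by (rewrite Z.even_sub, HJ; now rewrite Z.even_mul).
      simpl. rewrite HE. unfold frame, padd; simpl; f_equal; lia.
    + unfold frame, padd; simpl; f_equal; lia.
    + unfold frame, padd; simpl; f_equal; lia.
Qed.

(** * Counter arithmetic *)

Lemma pow_pos i : 0 <= i -> 0 < b ^ i.
Proof. intro. apply Z.pow_pos_nonneg; lia. Qed.

Lemma digit_range v i : 0 <= digit v i < b.
Proof. unfold digit. apply Z.mod_pos_bound. lia. Qed.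

(** With [B = b ^ i]: if [B] divides [v + 1], the quotient by [B] grows by 1, and digit [i] does so
    modulo [b]; otherwise the quotient is unchanged. The new carry follows from the splitting of
    [(v + 1) mod (B * b)] into [(v + 1) mod B] and digit [i]. *)
Lemma advance_digit v i : 0 <= i ->
  advance false ((v + 1) mod b ^ i =? 0) (digit v i) = ((v + 1) mod b ^ (i + 1) =? 0, digit (v + 1) i).
Proof.
  intro Hi. pose proof (pow_pos i Hi) as HB. unfold advance, digit.
  rewrite Z.pow_add_r, Z.pow_1_r by lia. set (B := b ^ i) in *.
  assert (EB : (v + 1) mod (B * b) = (v + 1) mod B + B * (((v + 1) / B) mod b))
    by (apply Z.rem_mul_r; lia).
  pose proof (Z.mod_pos_bound (v + 1) B ltac:(lia)) as M1.
  pose proof (Z.mod_pos_bound ((v + 1) / B) b ltac:(lia)) as M2.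
  pose proof (Z.div_mod (v + 1) B ltac:(lia)) as D1.
  rewrite EB. destruct (Z.eqb_spec ((v + 1) mod B) 0) as [M0|M0].
  - assert (Q : v / B = (v + 1) / B - 1).
    { symmetry. apply Z.div_unique with (B - 1); [lia|]. nia. }
    rewrite Q.
    pose proof (Z.mod_pos_bound ((v + 1) / B - 1) b ltac:(lia)) as M3.
    pose proof (Z.div_mod ((v + 1) / B) b ltac:(lia)) as D2.
    pose proof (Z.div_mod ((v + 1) / B - 1) b ltac:(lia)) as D3.
    set (q := (v + 1) / B) in *.
    destruct (Z.eqb_spec ((q - 1) mod b) (b - 1)) as [C|C].
    + assert (Z0 : q mod b = 0).
      { symmetry. apply Z.mod_unique with ((q - 1) / b + 1); [lia|]. nia. }
      rewrite M0, Z0. f_equal. symmetry. apply Z.eqb_eq. nia.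
    + assert (Z0 : q mod b = (q - 1) mod b + 1).
      { symmetry. apply Z.mod_unique with ((q - 1) / b); [lia|]. nia. }
      rewrite M0, Z0. f_equal. symmetry. apply Z.eqb_neq. nia.
  - assert (Q : v / B = (v + 1) / B).
    { symmetry. apply Z.div_unique with ((v + 1) mod B - 1); [lia|]. nia. }
    rewrite Q. f_equal. symmetry. apply Z.eqb_neq. nia.
Qed.

Lemma carry_step j c : 0 <= c ->
  advance (Z.even j) (carry j c) (digit (value (j - 1)) (digit_index j c)) =
  (carry j (c + 1), digit (value j) (digit_index j c)).
Proof.
  intro Hc. unfold carry, digit_index. evcase j; rewrite E.
  - unfold advance. do 2 f_equal. unfold value. zmod.
  - assert (Hv : value j = value (j - 1) + 1) by (unfold value; zmod).
    rewrite Hv. now apply advance_digit.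
Qed.

Lemma carry_start j : 1 <= j -> carry j 0 = if Z.even j then j =? J else true.
Proof. intro. unfold carry. rewrite Z.pow_0_r, Z.mod_1_r. now destruct (Z.even j). Qed.

(** After the odd passes the value runs through [b ^ k - m + 1] to [b ^ k], and only the last of
    these is a multiple of [b ^ k]. *)
Lemma carry_end j : 1 <= j <= J -> carry j k = if Z.even j then j =? J else j =? J - 1.
Proof.
  sizes. intro Hj. unfold carry. evcase j; rewrite E; [reflexivity|].
  pose proof (pow_pos k ltac:(lia)) as HB.
  assert (Hv : value j = b ^ k - m + (j + 1) / 2) by reflexivity.
  assert (Hr : 0 < (j + 1) / 2 <= m) by zmod.
  destruct (Z.eqb_spec j (J - 1)) as [->|D].
  - apply Z.eqb_eq. replace (value (J - 1)) with (b ^ k); [apply Z_mod_same_full|].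
    rewrite Hv. replace ((J - 1 + 1) / 2) with m by zmod. lia.
  - apply Z.eqb_neq. rewrite Z.mod_small; rewrite Hv; zmod.
Qed.

Lemma even_J : Z.even J = true.
Proof. sizes. rewrite HJ. now rewrite Z.even_mul. Qed.

Lemma even_pred j : Z.even (j - 1) = negb (Z.even j).
Proof. rewrite Z.even_sub. now destruct (Z.even j). Qed.

(* The last pass copies the digits and is the only even pass in which the overflow flag is set. *)
Lemma closing_iff j c : 1 <= j <= J -> Z.even j && carry j c = (j =? J).
Proof.
  intro Hj. unfold carry. evcase j; rewrite E; [reflexivity|].
  simpl. symmetry. apply Z.eqb_neq. intros ->. rewrite even_J in E. discriminate.
Qed.

(** Links the two descriptions of the assembly: the states that [st] prescribes by arithmetic are
    those that the local rules hand on, up to the digit that a reader has to find by itself. *)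
Lemma par_out a : valid a -> a <> root -> out_state (st (parent a)) (parent_dir a) = Some (norm (st a)).
Proof.
  sizes. intros Ha Hr.
  destruct a as [s x y|s j c u|s j u|x y]; simpl in *.
  - destruct Ha as [Hx Hy]. evcase x; rewrite E.
    + destruct (Z.eqb_spec y (- depth)); [destruct (Z.eqb_spec x 0)|]; simpl.
      * rewrite even_J, carry_end, even_J, Z.eqb_refl by lia. subst.
        destruct s; [now elim Hr| | |]; reflexivity.
      * assert (E1 : Z.even (x - 1) = false) by (rewrite even_pred, E; reflexivity).
        rewrite E1. subst y. rewrite Z.eqb_refl. simpl. do 2 f_equal. lia.
      * rewrite E. simpl. destruct (Z.ltb_spec (y - 1) (top x)); [|lia].
        simpl. do 2 f_equal. lia.
    + destruct (Z.eqb_spec y (top x)); simpl.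
      * assert (E1 : Z.even (x - 1) = true) by (rewrite even_pred, E; reflexivity).
        rewrite E1.
        replace (top (x - 1)) with (top x).
        2:{ replace x with (x - 1 + 1) at 1 by lia. apply top_next; auto. zmod. }
        destruct (Z.eqb_spec y (top x)); [|lia]. destruct (Z.eqb_spec (x - 1) (4 * k + 2)); [lia|].
        simpl. do 2 f_equal. lia.
      * rewrite E. destruct (Z.eqb_spec (y + 1) (- depth)); [lia|]. simpl. do 2 f_equal. lia.
  - destruct Ha as (Hj & Hc & Hu). destruct u.
    { destruct (Z.eqb_spec c 0); [destruct (Z.eqb_spec j 1)|]; simpl.
      - subst c j. rewrite carry_start by lia. simpl.
        destruct (Z.eqb_spec (4 * k + 2) (4 * k + 2)); [|lia].
        destruct (Z.eqb_spec 1 J); [lia|]. reflexivity.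
      - subst c. rewrite carry_start by lia. destruct (Z.eqb_spec j J); simpl.
        + subst j. rewrite even_J, even_pred, even_J. now destruct s.
        + rewrite carry_end, even_pred by lia. evcase j; rewrite E; simpl.
          * destruct (Z.eqb_spec (j - 1) (J - 1)); [lia|]. now destruct s.
          * destruct (Z.eqb_spec (j - 1) J); [lia|]. now destruct s.
      - replace (c - 1 + 1) with c by lia. destruct (Z.eqb_spec (c - 1) (k - 1)); [lia|].
        destruct (Z.ltb_spec 0 c); [|lia]. reflexivity. }
    5: destruct (Z.eqb_spec j J).
    all: simpl; rewrite ?carry_step, ?closing_iff by lia; try reflexivity.
    + destruct (Z.eqb_spec j J) as [->|]; [|reflexivity].
      exfalso. destruct (Hu eq_refl); congruence.
    + destruct (Z.eqb_spec j J); [reflexivity|congruence].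
    + destruct (Z.eqb_spec j J); [congruence|reflexivity].
    + unfold digit_index. destruct (Z.even j).
      * do 2 f_equal. destruct (Z.eqb_spec (k - 1 - c) 0), (Z.eqb_spec c (k - 1)); auto; lia.
      * reflexivity.
  - destruct Ha as (Hj & H6 & H5).
    assert (C5 : u = T5 -> Z.even j && carry j k = false).
    { intros ->. rewrite closing_iff by lia. apply Z.eqb_neq. specialize (H5 eq_refl). lia. }
    assert (C6 : u = T6 -> carry j k = true).
    { intros ->. rewrite H6 by auto. rewrite carry_end by lia.
      rewrite even_pred, even_J. simpl. apply Z.eqb_refl. }
    destruct u, s; simpl; try reflexivity;
      try (rewrite C5 by reflexivity; reflexivity); try (rewrite C6 by reflexivity; reflexivity).
    all: try (replace (k - 1 + 1) with k by lia; rewrite Z.eqb_refl; reflexivity).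
    all: destruct (Z.even j); try reflexivity; try (rewrite C5 by reflexivity; reflexivity);
      rewrite C6 by reflexivity; reflexivity.
  - destruct (Z.eqb_spec x w); [destruct (Z.eqb_spec y w)|]; simpl.
    + rewrite even_pred, even_J. reflexivity.
    + destruct (Z.eqb_spec x w); [reflexivity|lia].
    + destruct (Z.eqb_spec (x - 1) w); reflexivity.
Qed.

(** * The order of growth *)

(** Conditions on the keys of path cells, with the gaps of the path spelled out, so that finding the
    predecessor of a key is linear arithmetic. *)
Definition key_valid (x : Z * Z * Z * Z) : Prop :=
  let '(x1, x2, x3, x4) := x in
  0 <= x1 <= 3 /\
  ((x2 = 0 /\ 0 <= x3 <= 4 * k + 2 /\
    (if Z.even x3 then - depth <= x4 <= top x3 else - top x3 <= x4 <= depth)) \/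
   (1 <= x2 <= J /\ 0 <= x3 <= k /\ 0 <= x4 <= 7 /\
    (x3 = k -> (6 <= x4 -> x2 = J - 1) /\ (x4 = 5 -> x2 < J)) /\
    (x3 < k -> x2 = J -> x4 <> 3 /\ x4 <> 4))).

Lemma rk_range s : 0 <= rk s <= 3.
Proof. destruct s; simpl; lia. Qed.

Lemma key_valid_key a : valid a -> match a with AFill _ _ => True | _ => key_valid (key a) end.
Proof.
  sizes. intro Ha. destruct a as [s x y|s j c u|s j u|x y]; simpl in *; auto.
  all: split; [apply rk_range|].
  - left. split; [reflexivity|]. split; [lia|]. destruct (Z.even x); lia.
  - right. repeat (split; [destruct u; simpl; lia|]).
    intros _ Hj. destruct Ha as (_ & _ & Hu). specialize (Hu Hj).
    destruct u; simpl; try lia; destruct Hu; congruence.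
  - right. repeat (split; [destruct u; simpl; lia|]). split; [|lia].
    intros _. destruct Ha as (_ & H6 & H5).
    destruct u; simpl; split; try lia; intro; first [apply H6; auto | apply H5; auto].
Qed.

Lemma rk_inj s s' : rk s = rk s' -> s = s'.
Proof. destruct s, s'; simpl; intro; try reflexivity; discriminate. Qed.

Lemma rku_inj u u' : rku u = rku u' -> u = u'.
Proof. destruct u, u'; simpl; intro; try reflexivity; discriminate. Qed.

Lemma rkt_inj u u' : rkt u = rkt u' -> u = u'.
Proof. destruct u, u'; simpl; intro; try reflexivity; discriminate. Qed.

Definition is_fill (a : address) : bool := match a with AFill _ _ => true | _ => false end.

Lemma key_inj a a' : valid a -> valid a' -> is_fill a = false -> is_fill a' = false ->
  key a = key a' -> a = a'.
Proof.
  intros Ha Ha' Fa Fa' E.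
  destruct a as [s x y|s j c u|s j u|x y], a' as [s' x' y'|s' j' c' u'|s' j' u'|x' y'];
    simpl in *; try discriminate;
    pose proof (f_equal (fun t => fst (fst (fst t))) E) as E1;
    pose proof (f_equal (fun t => snd (fst (fst t))) E) as E2;
    pose proof (f_equal (fun t => snd (fst t)) E) as E3;
    pose proof (f_equal snd E) as E4;
    simpl in E1, E2, E3, E4; apply rk_inj in E1; subst s'; try lia.
  - f_equal; auto. rewrite E3 in E4. destruct (Z.even x'); lia.
  - apply rku_inj in E4. congruence.
  - apply rkt_inj in E4. congruence.
Qed.

Lemma lt_path a a' : is_fill a = false -> is_fill a' = false ->
  (lt a a' <-> valid a /\ valid a' /\ lexlt (key a) (key a')).
Proof. destruct a, a'; simpl; intros; try discriminate; reflexivity. Qed.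

Lemma is_fill_par a : is_fill a = false -> is_fill (parent a) = false.
Proof.
  destruct a as [s x y|s j c []|s j []|x y]; simpl; intro; try reflexivity; try discriminate.
  - destruct (Z.even x), (y =? - depth), (x =? 0), (y =? top x); reflexivity.
  - destruct (c =? 0), (j =? 1); reflexivity.
Qed.

Lemma rk_prev s : s <> S0 -> rk (prev_strip s) = rk s - 1.
Proof. intro Hs. now destruct s. Qed.

(** The path runs through the keys in lexicographic order without skipping any, which reduces
    [covers] to arithmetic on the tuples. *)
Lemma key_par a z : valid a -> is_fill a = false -> a <> root -> key_valid z ->
  lexlt (key (parent a)) (key a) /\
  (lexlt z (key a) -> lexlt z (key (parent a)) \/ z = key (parent a)).
Proof.
  sizes. intros Ha Fa Hr Hz. destruct z as [[[z1 z2] z3] z4].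
  assert (Fin : forall y1 y2 y3 y4, lexlt (z1, z2, z3, z4) (y1, y2, y3, y4) \/
     (z1 = y1 /\ z2 = y2 /\ z3 = y3 /\ z4 = y4) ->
     lexlt (z1, z2, z3, z4) (y1, y2, y3, y4) \/ (z1, z2, z3, z4) = (y1, y2, y3, y4)).
  { intros y1 y2 y3 y4 [Q|(-> & -> & -> & ->)]; auto. }
  unfold key_valid in Hz. destruct Hz as [Hz1 Hz].
  destruct a as [s x y|s j c u|s j u|x y]; simpl in Fa; try discriminate.
  - destruct Ha as [Hx Hy]. simpl. evcase x; rewrite E.
    + destruct (Z.eqb_spec y (- depth)); [destruct (Z.eqb_spec x 0)|].
      * assert (Hs : s <> S0) by (intro; subst; now elim Hr).
        simpl. rewrite (rk_prev s Hs). subst x y.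
        split; [lia|]. intro Hl. apply Fin. simpl.
        destruct Hz as [Hz|Hz]; [|lia].
        destruct (Z.eq_dec z3 0) as [->|]; [change (Z.even 0) with true in Hz|]; lia.
      * assert (E1 : Z.even (x - 1) = false) by (rewrite even_pred, E; reflexivity).
        cbn [key]. rewrite E1. split; [simpl; lia|]. intro Hl. apply Fin. simpl in *.
        destruct Hz as [Hz|Hz]; [|lia].
        destruct (Z.eq_dec z3 x) as [->|]; [rewrite E in Hz; lia|].
        destruct (Z.eq_dec z3 (x - 1)) as [->|]; [rewrite E1 in Hz; lia|lia].
      * cbn [key]. rewrite E. split; [simpl; lia|]. intro Hl. apply Fin. simpl in *. lia.
    + assert (E1 : Z.even (x - 1) = true) by (rewrite even_pred, E; reflexivity).
      assert (Ht : top x = top (x - 1)).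
      { replace x with (x - 1 + 1) at 1 by lia. apply top_next; auto. zmod. }
      destruct (Z.eqb_spec y (top x)).
      * cbn [key]. rewrite E1. split; [simpl; lia|]. intro Hl. apply Fin. simpl in *.
        destruct Hz as [Hz|Hz]; [|lia].
        destruct (Z.eq_dec z3 x) as [->|]; [rewrite E in Hz; lia|].
        destruct (Z.eq_dec z3 (x - 1)) as [->|]; [rewrite E1 in Hz; lia|lia].
      * cbn [key]. rewrite E. split; [simpl; lia|]. intro Hl. apply Fin. simpl in *. lia.
  - destruct Ha as (Hj & Hc & Hu). destruct u; cbn [parent].
    { destruct (Z.eqb_spec c 0); [destruct (Z.eqb_spec j 1)|]; cbn [key].
      - replace (Z.even (4 * k + 2)) with true by (rewrite Z.even_add, Z.even_mul; reflexivity).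
        split; [simpl; lia|]. intro Hl. apply Fin. simpl in *.
        destruct Hz as [Hz|Hz]; [|lia].
        destruct (Z.eq_dec z3 (4 * k + 2)) as [->|]; [|lia].
        rewrite top_last, Z.even_add, Z.even_mul in Hz. simpl in Hz. lia.
      - destruct (Z.eqb_spec j J); (split; [simpl; lia|]); intro Hl; apply Fin; simpl in *; lia.
      - split; [simpl; lia|]. intro Hl. apply Fin. simpl in *. lia. }
    5: destruct (Z.eqb_spec j J).
    all: (split; [simpl; lia|]); intro Hl; apply Fin; simpl in *; lia.
  - destruct Ha as (Hj & H6 & H5).
    destruct u; cbn [parent]; (split; [simpl; lia|]); intro Hl; apply Fin; simpl in *; try lia.
Qed.

(** On the path the order is linear and [key_par] applies. In the fill, what precedes a trunk cell
    lies at or before the trunk cell below it, and what precedes a row cell lies at or before its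
    left neighbour. *)
Lemma par_covers a : valid a -> a <> root -> covers address valid lt (parent a) a.
Proof.
  intros Ha Hr. pose proof (par_valid a Ha Hr) as Hp.
  destruct (is_fill a) eqn:Fa.
  - destruct a as [| | |x y]; try discriminate. destruct Ha as [Hx Hy].
    assert (HT : valid (ATurn S3 (J - 1) T6)).
    { sizes. simpl. vsolve. }
    split.
    + split; [exact Hp|]. split; [simpl; lia|]. simpl.
      destruct (Z.eqb_spec x w); [destruct (Z.eqb_spec y w)|]; simpl; auto; lia.
    + intros z Hz (_ & _ & Hl). simpl.
      destruct (Z.eqb_spec x w); [destruct (Z.eqb_spec y w)|]; simpl.
      * destruct (is_fill z) eqn:Fz.
        { destruct z; try discriminate. simpl in *. lia. }
        assert (Q : lexlt (key z) (3, J - 1, k, 6) \/ key z = (3, J - 1, k, 6))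
          by (destruct z; try discriminate; exact Hl).
        destruct Q as [Q|Q].
        { right. apply lt_path; auto. }
        { left. apply key_inj; auto. }
      * destruct z as [| | |x' y']; try (right; split; [exact Hz|]; split; [simpl; lia|]; exact Hl).
        simpl in Hz. destruct (Z.eq_dec y' (y - 1)).
        { left. f_equal; lia. }
        right. split; [simpl; lia|]. split; simpl; lia.
      * destruct z as [| | |x' y']; try (right; split; [exact Hz|]; split; [simpl; lia|]; exact Hl).
        simpl in Hz. destruct (Z.eq_dec x' (x - 1)), (Z.eq_dec y' y).
        { left. f_equal; lia. }
        all: right; split; [simpl; lia|]; split; simpl; lia.
  - pose proof (is_fill_par a Fa) as Fp. split.
    + apply lt_path; auto. split; [exact Hp|]. split; [exact Ha|].
      pose proof (key_valid_key a Ha) as Hk. destruct a; try discriminate;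
      now apply (key_par _ _ Ha eq_refl Hr Hk).
    + intros z Hz Hl.
      assert (Fz : is_fill z = false).
      { destruct z; auto. destruct Hl as (_ & _ & Hl). destruct a; simpl in *; tauto || discriminate. }
      apply lt_path in Hl as (_ & _ & Hl); auto.
      assert (Hk : key_valid (key z)).
      { pose proof (key_valid_key z Hz). destruct z; auto; discriminate. }
      destruct (proj2 (key_par a (key z) Ha Fa Hr Hk) Hl) as [Q|Q].
      * right. apply lt_path; auto.
      * left. apply key_inj; auto.
Qed.

Lemma root_lowest z : valid z -> ~ lt z root.
Proof.
  intros Hz Hl. unfold root in Hl.
  destruct z as [s x y|s j c u|s j u|x y]; destruct Hl as (_ & _ & Hl); simpl in *; auto.
  - pose proof (rk_range s). evcase x; rewrite E in *; [lia|].
    destruct (Z.eq_dec x 0) as [->|]; [discriminate|lia].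
  - pose proof (rk_range s). lia.
  - pose proof (rk_range s). lia.
Qed.

Definition bound : Z := 4 * k + J + 2 * depth + 16.

(** Reads a key as a numeral in base [bound]; the shift by [depth + 1] keeps its last digit
    nonnegative. The leading digit is less than 4, so the fill starts above all path cells. *)
Definition rank (a : address) : Z :=
  match a with
  | AFill x y => 4 * bound * bound * bound + x + y
  | _ => let '(x1, x2, x3, x4) := key a in ((x1 * bound + x2) * bound + x3) * bound + (x4 + depth + 1)
  end.

Lemma radix_lt B u v x y : 0 <= u -> 0 <= x < B -> 0 <= y < B -> u < v \/ (u = v /\ x < y) ->
  u * B + x < v * B + y.
Proof. nia. Qed.

Lemma rank_key a : valid a -> is_fill a = false ->
  let '(x1, x2, x3, x4) := key a in
  0 <= x1 < 4 /\ 0 <= x2 < bound /\ 0 <= x3 < bound /\ 0 <= x4 + depth + 1 < bound /\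
  rank a = ((x1 * bound + x2) * bound + x3) * bound + (x4 + depth + 1).
Proof.
  sizes. intros Ha Fa. pose proof (key_valid_key a Ha) as Hk.
  assert (Hk' : key_valid (key a)) by (destruct a; auto; discriminate).
  assert (Hr : rank a = let '(x1, x2, x3, x4) := key a in
     ((x1 * bound + x2) * bound + x3) * bound + (x4 + depth + 1)) by (destruct a; auto; discriminate).
  destruct (key a) as [[[x1 x2] x3] x4]. unfold key_valid in Hk'. unfold bound in *.
  tcase x3; destruct (Z.even x3); repeat split; auto; lia.
Qed.

Lemma rank_lt a a' : lt a a' -> 0 <= rank a < rank a'.
Proof.
  sizes. intros (Ha & Ha' & Hl).
  assert (HB : 1 <= bound) by (unfold bound; lia).
  destruct (is_fill a) eqn:Fa, (is_fill a') eqn:Fa'.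
  - destruct a, a'; try discriminate. simpl in *. nia.
  - destruct a, a'; try discriminate; simpl in *; tauto.
  - pose proof (rank_key a Ha Fa) as R. destruct (key a) as [[[x1 x2] x3] x4].
    destruct R as (R1 & R2 & R3 & R4 & ->).
    destruct a'; try discriminate. simpl in Ha'. simpl rank.
    assert (x1 * bound + x2 < 4 * bound) by nia.
    assert ((x1 * bound + x2) * bound + x3 < 4 * bound * bound) by nia.
    split; [|nia]. assert (0 <= x1 * bound + x2) by nia.
    assert (0 <= (x1 * bound + x2) * bound + x3) by nia. nia.
  - pose proof (proj1 (lt_path a a' Fa Fa') (conj Ha (conj Ha' Hl))) as Hl'.
    pose proof (rank_key a Ha Fa) as R. pose proof (rank_key a' Ha' Fa') as R'.
    destruct Hl' as (_ & _ & Hl').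
    destruct (key a) as [[[x1 x2] x3] x4], (key a') as [[[y1 y2] y3] y4]. simpl in Hl'.
    destruct R as (R1 & R2 & R3 & R4 & ->), R' as (Q1 & Q2 & Q3 & Q4 & ->).
    assert (0 <= x1 * bound + x2) by nia.
    assert (0 <= (x1 * bound + x2) * bound + x3) by nia.
    split; [nia|]. apply radix_lt; auto.
    destruct (Z.eq_dec x1 y1) as [->|D1].
    + destruct (Z.eq_dec x2 y2) as [->|D2].
      * destruct (Z.eq_dec x3 y3) as [->|D3]; [right|left]; lia.
      * left. apply radix_lt; auto. left. lia.
    + left. apply radix_lt; auto. left. apply radix_lt; auto; lia.
Qed.

Lemma lt_wf : well_founded lt.
Proof.
  apply wf_incl with (fun a a' => (Z.to_nat (rank a) < Z.to_nat (rank a'))%nat).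
  - intros a a' Hl. apply rank_lt in Hl. lia.
  - apply (wf_inverse_image address nat Nat.lt (fun a => Z.to_nat (rank a))), Nat.lt_wf_0.
Qed.

(** * The cells fill the square exactly once *)

Lemma even_cases j : (exists h, j = 2 * h /\ Z.even j = true) \/
  (exists h, j = 2 * h + 1 /\ Z.even j = false).
Proof.
  evcase j; [left; exists (j / 2)|right; exists (j / 2)]; split; auto; zmod.
Qed.

Lemma top_shape x : 0 <= x -> (x < 2 /\ top x = -1) \/
  exists h, 2 <= x /\ ((x = 4 * h /\ top x = 0) \/ (x = 4 * h + 1 /\ top x = 0) \/
            (x = 4 * h + 2 /\ top x = 1) \/ (x = 4 * h + 3 /\ top x = 1)).
Proof.
  intro Hx. tcase x; [left; auto|right; exists (x / 4)|right; exists (x / 4)]; zmod.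
Qed.

Ltac jcase j := destruct (even_cases j) as [(? & ? & ?E)|(? & ? & ?E)].

Ltac tspec H5 H6 :=
  try specialize (H5 eq_refl);
  first [specialize (H6 (or_introl eq_refl)) | specialize (H6 (or_intror eq_refl)) | idtac].

Lemma frame_range a : valid a -> is_fill a = false ->
  0 <= fst (frame (adr_par a) (cpos a)) <= 4 * k + 2 /\
  0 <= snd (frame (adr_par a) (cpos a)) < H.
Proof.
  sizes. intros Ha Fa. destruct a as [s x y|s j c u|s j u|x y]; try discriminate; simpl in *.
  - destruct Ha. tcase x; lia.
  - destruct Ha as (Hj & Hc & Hu). jcase j; rewrite E.
    + destruct u; simpl; try lia; split; try lia;
        destruct (Z.eq_dec j J) as [D|]; try lia; specialize (Hu D); destruct Hu; congruence.
    + destruct u; simpl; lia.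
  - destruct Ha as (Hj & H6 & H5). jcase j; rewrite E; destruct u; tspec H5 H6; simpl; lia.
Qed.

(** The pattern has period 4 in both directions, so fixing the parities of the passes and the kinds
    of cells leaves linear systems. *)
Lemma frame_inj a a' : valid a -> valid a' -> is_fill a = false -> is_fill a' = false ->
  adr_strip a = adr_strip a' ->
  frame (adr_par a) (cpos a) = frame (adr_par a') (cpos a') -> a = a'.
Proof.
  sizes.
  assert (SeedCase : forall s x y a, valid (ASeed s x y) -> valid a -> s = adr_strip a ->
    frame true (x, y) = frame (adr_par a) (cpos a) ->
    match a with ASeed _ _ _ => a = ASeed s x y | AFill _ _ => True | _ => False end).
  { clear a a'. intros s x y a Hx Ha Hs Hf. destruct Hx as [Hx Hy].
    unfold frame in Hf.
    destruct a as [s' x' y'|s' j' c' u'|s' j' u'|x' y']; simpl in *; auto; subst s';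
      injection Hf as F1 F2.
    - f_equal; lia.
    - destruct Ha as (Hj & Hc & _). jcase j'; rewrite E in *;
        destruct (top_shape x (proj1 Hx)) as [[? ?]|(h & ? & [[? ?]|[[? ?]|[[? ?]|[? ?]]]])];
        destruct u'; simpl in *; lia.
    - destruct Ha as (Hj & H6 & H5). jcase j'; rewrite E in *;
        destruct (top_shape x (proj1 Hx)) as [[? ?]|(h & ? & [[? ?]|[[? ?]|[[? ?]|[? ?]]]])];
        destruct u'; tspec H5 H6; simpl in *; lia. }
  assert (TurnCase : forall s j u s' j' c' u', valid (ATurn s j u) -> valid (ACell s' j' c' u') ->
    frame (Z.even j) (cpos (ATurn s j u)) = frame (Z.even j') (cpos (ACell s' j' c' u')) -> False).
  { intros s j u s' j' c' u' (Hj & H6 & H5) (Hj' & Hc' & Hu') Hf.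
    unfold frame in Hf. simpl in *. injection Hf as F1 F2.
    jcase j; jcase j'; rewrite E, E0 in *; destruct u; tspec H5 H6; destruct u'; simpl in *; lia. }
  intros Ha Ha' Fa Fa' Hs Hf.
  destruct a as [s x y|s j c u|s j u|x y], a' as [s' x' y'|s' j' c' u'|s' j' u'|x' y'];
    try discriminate; simpl in Hs; subst s'.
  - symmetry. exact (SeedCase s x y _ Ha Ha' eq_refl Hf).
  - now elim (SeedCase s x y _ Ha Ha' eq_refl Hf).
  - now elim (SeedCase s x y _ Ha Ha' eq_refl Hf).
  - now elim (SeedCase s x' y' _ Ha' Ha eq_refl (eq_sym Hf)).
  - unfold frame in Hf. simpl in Ha, Ha', Hf. injection Hf as F1 F2.
    destruct Ha as (Hj & Hc & Hu), Ha' as (Hj' & Hc' & Hu').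
    assert (G : j = j' /\ c = c' /\ u = u').
    { jcase j; jcase j'; rewrite E, E0 in *; destruct u, u'; simpl in *;
        try (exfalso; lia); repeat split; lia. }
    destruct G as (-> & -> & ->). reflexivity.
  - now elim (TurnCase s j' u' s j c u Ha' Ha (eq_sym Hf)).
  - now elim (SeedCase s x' y' _ Ha' Ha eq_refl (eq_sym Hf)).
  - now elim (TurnCase s j u s j' c' u' Ha Ha' Hf).
  - unfold frame in Hf. simpl in Ha, Ha', Hf. injection Hf as F1 F2.
    destruct Ha as (Hj & H6 & H5), Ha' as (Hj' & H6' & H5').
    assert (G : j = j' /\ u = u').
    { jcase j; jcase j'; rewrite E, E0 in *; destruct u; tspec H5 H6; destruct u'; tspec H5' H6';
        simpl in *; first [exfalso; lia | repeat split; lia]. }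
    destruct G as (-> & ->). reflexivity.
Qed.

(** Adjacent strips are disjoint by [N = H + w], opposite ones by [thin]. *)
Lemma rotp_inj s s' x y x' y' :
  0 <= x <= 4 * k + 2 -> 0 <= y < H -> 0 <= x' <= 4 * k + 2 -> 0 <= y' < H ->
  rotp s (x, y) = rotp s' (x', y') -> s = s' /\ x = x' /\ y = y'.
Proof.
  sizes. intros Hx Hy Hx' Hy' E.
  destruct s, s'; simpl in E; injection E as E1 E2; lia || (split; [reflexivity|lia]).
Qed.

Lemma rotp_outside s x y u v : 0 <= x <= 4 * k + 2 -> 0 <= y < H -> w <= u < H -> w <= v < H ->
  rotp s (x, y) <> (u, v).
Proof.
  sizes. intros Hx Hy Hu Hv E. destruct s; simpl in E; injection E as E1 E2; lia.
Qed.

Lemma pos_fill x y : pos (AFill x y) = (x, y).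
Proof. unfold pos, frame. simpl. f_equal. lia. Qed.

Lemma pos_inj a a' : valid a -> valid a' -> pos a = pos a' -> a = a'.
Proof.
  intros Ha Ha' Hp. destruct (is_fill a) eqn:Fa, (is_fill a') eqn:Fa'.
  - destruct a, a'; try discriminate. rewrite !pos_fill in Hp. congruence.
  - destruct a; try discriminate. rewrite pos_fill in Hp.
    destruct (frame_range a' Ha' Fa') as [R1 R2]. unfold pos in Hp.
    destruct (frame _ (cpos a')) as [x' y']. simpl in Ha.
    elim (rotp_outside (adr_strip a') x' y' x y); auto; tauto.
  - destruct a'; try discriminate. rewrite pos_fill in Hp.
    destruct (frame_range a Ha Fa) as [R1 R2]. unfold pos in Hp.
    destruct (frame _ (cpos a)) as [x' y']. simpl in Ha'.
    elim (rotp_outside (adr_strip a) x' y' x y); auto; tauto.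
  - destruct (frame_range a Ha Fa) as [R1 R2], (frame_range a' Ha' Fa') as [R3 R4].
    pose proof (frame_inj a a' Ha Ha' Fa Fa') as FI. unfold pos in Hp.
    destruct (frame (adr_par a) (cpos a)) as [x y], (frame (adr_par a') (cpos a')) as [x' y'].
    destruct (rotp_inj _ _ x y x' y' R1 R2 R3 R4 Hp) as (E1 & -> & ->). auto.
Qed.

Lemma even_double q : Z.even (2 * q) = true.
Proof. now rewrite Z.even_mul. Qed.

Lemma even_double_succ q : Z.even (2 * q + 1) = false.
Proof. now rewrite Z.even_add, even_double. Qed.

(** A pass spends 8 cells on a digit, so two passes fill blocks of 4 by 4 cells, in which the
    residues of the coordinates modulo 4 name the cell. The first row and the two columns at either
    margin are treated separately. *)
Lemma strip_cover s X y : 0 <= X <= 4 * k + 2 -> - depth <= y <= 4 * m ->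
  exists a, valid a /\ is_fill a = false /\ adr_strip a = s /\
    pos a = rotp s (X, y + depth).
Proof.
  sizes. intros HX Hy.
  assert (By : forall a, valid a -> is_fill a = false -> adr_strip a = s ->
    frame (adr_par a) (cpos a) = (X, y + depth) ->
    exists a, valid a /\ is_fill a = false /\ adr_strip a = s /\
    pos a = rotp s (X, y + depth)).
  { intros a Ha Fa <- <-. exists a. auto. }
  assert (Even : forall q c u, valid (ACell s (2 * q) c u) ->
    (4 * k + 2 - fst (cpos (ACell s (2 * q) c u)) = X /\ snd (cpos (ACell s (2 * q) c u)) = y) ->
    exists a, valid a /\ is_fill a = false /\ adr_strip a = s /\
    pos a = rotp s (X, y + depth)).
  { intros q c u Ha [E1 E2]. apply (By _ Ha); auto. simpl adr_par.
    rewrite even_double. unfold frame. now rewrite E1, E2. }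
  assert (Odd : forall q c u, valid (ACell s (2 * q + 1) c u) ->
    (fst (cpos (ACell s (2 * q + 1) c u)) = X /\ snd (cpos (ACell s (2 * q + 1) c u)) = y) ->
    exists a, valid a /\ is_fill a = false /\ adr_strip a = s /\
    pos a = rotp s (X, y + depth)).
  { intros q c u Ha [E1 E2]. apply (By _ Ha); auto. simpl adr_par.
    rewrite even_double_succ. unfold frame. now rewrite E1, E2. }
  assert (EvenT : forall q u, valid (ATurn s (2 * q) u) ->
    (4 * k + 2 - fst (cpos (ATurn s (2 * q) u)) = X /\ snd (cpos (ATurn s (2 * q) u)) = y) ->
    exists a, valid a /\ is_fill a = false /\ adr_strip a = s /\
    pos a = rotp s (X, y + depth)).
  { intros q u Ha [E1 E2]. apply (By _ Ha); auto. simpl adr_par.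
    rewrite even_double. unfold frame. now rewrite E1, E2. }
  assert (OddT : forall q u, valid (ATurn s (2 * q + 1) u) ->
    (fst (cpos (ATurn s (2 * q + 1) u)) = X /\ snd (cpos (ATurn s (2 * q + 1) u)) = y) ->
    exists a, valid a /\ is_fill a = false /\ adr_strip a = s /\
    pos a = rotp s (X, y + depth)).
  { intros q u Ha [E1 E2]. apply (By _ Ha); auto. simpl adr_par.
    rewrite even_double_succ. unfold frame. now rewrite E1, E2. }
  destruct (Z_le_gt_dec y (top (4 * k + 2 - X))) as [Ht|Ht].
  { apply (By (ASeed s (4 * k + 2 - X) y)); auto.
    - simpl. lia.
    - unfold frame; simpl. f_equal. lia. }
  assert (R : exists h r, y = 4 * h + r /\ 0 <= r < 4)
    by (exists (y / 4), (y mod 4); zmod).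
  destruct R as (h & r & Hr & Hr4).
  assert (R : r = 0 \/ r = 1 \/ r = 2 \/ r = 3) by lia.
  destruct (Z.eq_dec X 0) as [->|X0].
  { replace (4 * k + 2 - 0) with (4 * k + 2) in Ht by lia. rewrite top_last in Ht.
    destruct R as [->|[->|[->| ->]]];
      [apply (EvenT h T4) | apply (EvenT h T5) |
       apply (EvenT (h + 1) T2) | apply (EvenT (h + 1) T3)]; simpl; vsolve. }
  destruct (Z.eq_dec X 1) as [->|X1].
  { replace (4 * k + 2 - 1) with (4 * k + 1) in Ht by lia. tcase (4 * k + 1); try zmod.
    destruct R as [->|[->|[->| ->]]].
    - apply (Even h (k - 1) U7); simpl; vsolve.
    - apply (Odd h 0 U0); simpl; vsolve.
    - apply (EvenT (h + 1) T1); simpl; vsolve.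
    - apply (EvenT (h + 1) T0); simpl; vsolve. }
  destruct (Z.eq_dec X (4 * k + 2)) as [->|X2].
  { replace (4 * k + 2 - (4 * k + 2)) with 0 in Ht by lia. change (top 0) with (-1) in Ht.
    destruct (Z.eq_dec y (4 * m)) as [Hm|Hm].
    { apply (OddT (m - 1) T6); simpl; vsolve. }
    destruct R as [->|[->|[->| ->]]];
      [apply (OddT h T2) | apply (OddT h T3) |
       apply (OddT h T4) | apply (OddT h T5)]; simpl; vsolve. }
  destruct (Z.eq_dec X (4 * k + 1)) as [->|X3].
  { replace (4 * k + 2 - (4 * k + 1)) with 1 in Ht by lia. change (top 1) with (-1) in Ht.
    destruct (Z.eq_dec y (4 * m)) as [Hm|Hm].
    { apply (OddT (m - 1) T7); simpl; vsolve. }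
    destruct R as [->|[->|[->| ->]]].
    - apply (OddT h T1); simpl; vsolve.
    - apply (OddT h T0); simpl; vsolve.
    - apply (Odd h (k - 1) U7); simpl; vsolve.
    - apply (Even (h + 1) 0 U0); simpl; vsolve. }
  assert (Q : exists c r', X = 4 * c + r' /\ 0 <= r' < 4)
    by (exists (X / 4), (X mod 4); zmod).
  destruct Q as (c & r' & Hc & Hr').
  assert (Q : r' = 0 \/ r' = 1 \/ r' = 2 \/ r' = 3) by lia.
  destruct (top_shape (4 * k + 2 - X) ltac:(lia)) as [[? ?]|(g & Hg & Hs)]; [lia|].
  destruct Q as [->|[->|[->| ->]]].
  - assert (Ht' : 2 <= y) by lia.
    destruct R as [->|[->|[->| ->]]];
      [apply (Even h (k - c) U2) | apply (Even h (k - c) U3) |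
       apply (Odd h (c - 1) U6) | apply (Even (h + 1) (k - c) U1)]; simpl; vsolve.
  - assert (Ht' : 1 <= y) by lia.
    destruct R as [->|[->|[->| ->]]];
      [apply (Even h (k - 1 - c) U7) | apply (Odd h c U0) |
       apply (Odd h (c - 1) U7) | apply (Even (h + 1) (k - c) U0)]; simpl; vsolve.
  - assert (Ht' : 1 <= y) by lia.
    destruct R as [->|[->|[->| ->]]];
      [apply (Even h (k - 1 - c) U6) | apply (Odd h c U1) |
       apply (Odd h c U2) | apply (Odd h c U3)]; simpl; vsolve.
  - assert (Ht' : 2 <= y) by lia.
    destruct R as [->|[->|[->| ->]]];
      [apply (Even h (k - 1 - c) U5) | apply (Even h (k - 1 - c) U4) |
       apply (Odd h c U5) | apply (Odd h c U4)]; simpl; vsolve.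
Qed.

Lemma pos_square x : (0 <= fst x < N /\ 0 <= snd x < N) <-> exists a, valid a /\ pos a = x.
Proof.
  sizes. destruct x as [x y]. simpl. split.
  - intros [Hx Hy].
    assert (Strip : forall s X Y, 0 <= X <= 4 * k + 2 -> 0 <= Y < H -> rotp s (X, Y) = (x, y) ->
      exists a, valid a /\ pos a = (x, y)).
    { intros s X Y HX HY E.
      destruct (strip_cover s X (Y - depth)) as (a & Ha & _ & _ & Hp); [lia|lia|].
      exists a. split; auto. rewrite Hp, <- E. do 2 f_equal. lia. }
    destruct (Z_lt_le_dec x w), (Z_lt_le_dec y H), (Z_lt_le_dec x H), (Z_lt_le_dec y w); try lia;
      first [ apply (Strip S0 x y); simpl; [lia|lia|f_equal; lia]
            | apply (Strip S1 (N - 1 - y) x); simpl; [lia|lia|f_equal; lia]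
            | apply (Strip S2 (N - 1 - x) (N - 1 - y)); simpl; [lia|lia|f_equal; lia]
            | apply (Strip S3 y (N - 1 - x)); simpl; [lia|lia|f_equal; lia]
            | exists (AFill x y); split; [simpl; lia|apply pos_fill] ].
  - intros (a & Ha & Hp). destruct (is_fill a) eqn:Fa.
    + destruct a; try discriminate. rewrite pos_fill in Hp. injection Hp as <- <-.
      simpl in Ha. lia.
    + destruct (frame_range a Ha Fa) as [R1 R2]. unfold pos in Hp.
      destruct (frame _ (cpos a)) as [X Y]. simpl in R1, R2.
      destruct (adr_strip a); simpl in Hp; injection Hp as <- <-; lia.
Qed.

(** * Edge bonds and the finite list of states *)

(** Excludes states of the first row that break [out_state_opp], for example one just above the top
    of an odd column, which would feed the top cell from the wrong side. *)
Definition ok (a : state) : Prop :=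
  match a with Seed _ x y => 0 <= x <= 4 * k + 2 /\ - depth <= y <= top x | _ => True end.

Lemma ok_st a : valid a -> ok (st a).
Proof.
  destruct a as [s x y|s j c []|s j u|x y]; simpl; auto. destruct (x =? w); simpl; auto.
Qed.

Lemma face_of_tdir a e : face_of a (tdir (state_strip a) (state_par a) e) = cface a e.
Proof. unfold face_of. now rewrite itdir_tdir. Qed.

Lemma cface_edge a a0 e : cface a e = Lab (Bond a0) ->
  (e = in_dir a /\ a0 = norm a) \/ out_state a e = Some a0.
Proof.
  unfold cface. destruct (dir_eq_dec e (in_dir a)).
  - intro E. injection E as <-. auto.
  - destruct (out_state a e) as [a'|]; [intro E; injection E as <-; auto|].
    destruct (neg_on a e); [discriminate|]. intro E.
    assert (Hd : data_on a e = Some (Bond a0)) by (destruct (data_on a e); congruence).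
    exfalso. destruct a as [s x y|s p q v|s p u q d bl br|s p q l|s p u q| |], e; simpl in Hd;
      try discriminate.
    + destruct ((x mod 4 =? 0) && (0 <? x) && (y =? 0)); discriminate.
    + destruct u, (p && q); discriminate.
    + destruct u; discriminate.
    + destruct u; discriminate.
    + destruct u; discriminate.
Qed.

Lemma cface_data a l e : cface a e = Lab l -> is_edge l = false -> data_on a e = Some l.
Proof.
  unfold cface. intros E El. destruct (dir_eq_dec e (in_dir a)).
  - injection E as <-. discriminate.
  - destruct (out_state a e) as [a'|]; [injection E as <-; discriminate|].
    destruct (neg_on a e); [discriminate|]. destruct (data_on a e); congruence.
Qed.

Lemma cface_neg a e : cface a e = Neg -> neg_on a e = true.
Proof.
  unfold cface. destruct (dir_eq_dec e (in_dir a)); [discriminate|].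
  destruct (out_state a e); [discriminate|]. destruct (neg_on a e); auto.
  destruct (data_on a e); discriminate.
Qed.

Lemma in_dir_norm a : in_dir (norm a) = in_dir a.
Proof. now destruct a as [| |? ? []| | | |]. Qed.

Lemma strip_norm a : state_strip (norm a) = state_strip a.
Proof. now destruct a as [| |? ? []| | | |]. Qed.

Lemma par_norm a : state_par (norm a) = state_par a.
Proof. now destruct a as [| |? ? []| | | |]. Qed.

Lemma face_in a : face_of a (tdir (state_strip a) (state_par a) (in_dir a)) = Lab (Bond (norm a)).
Proof.
  rewrite face_of_tdir. unfold cface. destruct (dir_eq_dec (in_dir a) (in_dir a)); congruence.
Qed.

Lemma only_some c a a' : only c a = Some a' -> c = true /\ a' = a.
Proof. destruct c; simpl; intro E; inversion E; auto. Qed.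

Ltac zbool :=
  repeat match goal with
  | H : context [(?x =? ?y)] |- _ => destruct (Z.eqb_spec x y)
  | H : context [(?x <? ?y)] |- _ => destruct (Z.ltb_spec x y)
  | |- context [(?x =? ?y)] => destruct (Z.eqb_spec x y)
  | |- context [(?x <? ?y)] => destruct (Z.ltb_spec x y)
  end.

Lemma out_state_in_dir a e a' : ok a -> out_state a e = Some a' -> e <> in_dir a.
Proof.
  intros Ha E. destruct a as [s x y|s p q v|s p u q d bl br|s p q l|s p u q| |].
  - destruct Ha as [Hx Hy]. destruct e; simpl in *; apply only_some in E as [E ->].
    + destruct (Z.even x); [|discriminate]. clear E.
      destruct (y =? - depth); intro; discriminate.
    + clear E. destruct (Z.even x), (y =? - depth), (y =? top x); simpl; intro; discriminate.
    + destruct (Z.even x); [discriminate|]. clear E.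
      destruct (y =? top x); intro; discriminate.
    + apply andb_prop in E as [E1 E2]. apply Z.eqb_eq in E1, E2. subst.
      rewrite Z.even_add, Z.even_mul. simpl. destruct (Z.eqb_spec 1 (- depth)); [lia|discriminate].
  - destruct e; simpl in E; try discriminate. destruct v; discriminate.
  - destruct u, e; simpl in E; try discriminate; simpl; destruct (p && q); discriminate.
  - destruct e; simpl in E; discriminate.
  - destruct u, e, s, p; simpl in E; try discriminate.
  - destruct e; simpl in E; try discriminate.
  - destruct e; simpl in E; try discriminate.
Qed.

Lemma face_out a e a' : ok a -> out_state a e = Some a' ->
  face_of a (tdir (state_strip a) (state_par a) e) = Lab (Bond a').
Proof.
  intros Ha E. rewrite face_of_tdir. unfold cface.
  destruct (dir_eq_dec e (in_dir a)) as [D|D]; [now elim (out_state_in_dir a e a')|]. now rewrite E.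
Qed.

(** The label of an edge bond fixes the absolute direction of the step, so two tiles can share it
    only as predecessor and successor. *)
Lemma out_state_opp a e a' : ok a -> out_state a e = Some a' ->
  tdir (state_strip a') (state_par a') (in_dir a') = dopp (tdir (state_strip a) (state_par a) e).
Proof.
  intros Ha E. rewrite <- tdir_dopp.
  destruct a as [s x y|s p q v|s p u q d bl br|s p q l|s p u q| |].
  - destruct Ha as [Hx Hy]. destruct e; cbn [out_state] in E; apply only_some in E as [E ->];
      cbn [state_strip state_par].
    + apply andb_prop in E as [E1 E2]. f_equal. simpl. rewrite E1.
      destruct (Z.eqb_spec (y + 1) (- depth)); [lia|reflexivity].
    + f_equal. simpl. evcase x; rewrite E0 in E.
      * apply andb_prop in E as [E1 E2]. apply Z.eqb_eq in E1.
        destruct (Z.eqb_spec x (4 * k + 2)); [discriminate|].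
        replace (Z.even (x + 1)) with false by (rewrite Z.even_add, E0; reflexivity).
        rewrite top_next; auto; [|zmod]. destruct (Z.eqb_spec y (top x)); [reflexivity|lia].
      * replace (Z.even (x + 1)) with true by (rewrite Z.even_add, E0; reflexivity).
        now rewrite E.
    + f_equal. simpl. destruct (Z.even x); [discriminate|].
      destruct (Z.eqb_spec (y - 1) (top x)); [lia|reflexivity].
    + simpl. now destruct s.
  - destruct e; simpl in E; try discriminate. injection E as <-. reflexivity.
  - destruct u, e; cbn [out_state] in E; try discriminate.
    1: destruct (advance p q d) as [q' d'].
    all: try apply only_some in E as [E' E]; try injection E as <-; subst; simpl in *; try reflexivity.
    + rewrite E'. reflexivity.
    + destruct (p && q); [discriminate|reflexivity].
  - destruct e; simpl in E; try discriminate. injection E as <-. destruct l; reflexivity.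
  - destruct u, e, s, p; cbn [out_state] in E; try discriminate; simpl in E;
      try destruct q; simpl in E; try discriminate; injection E as <-;
      first [reflexivity | unfold in_dir; rewrite Z.eqb_refl; reflexivity].
  - destruct e; simpl in E; try discriminate; injection E as <-; reflexivity.
  - destruct e; simpl in E; try discriminate; injection E as <-; reflexivity.
Qed.

Lemma parent_spec a : valid a -> a <> root ->
  exists p d l, valid p /\ covers address valid lt p a /\ pos a = padd (pos p) (dvec d) /\
    is_edge l = true /\ face_of (st p) d = Lab l /\ face_of (st a) (dopp d) = Lab l.
Proof.
  intros Ha Hr. exists (parent a), (tdir (adr_strip (parent a)) (adr_par (parent a)) (parent_dir a)),
    (Bond (norm (st a))).
  pose proof (par_valid a Ha Hr) as Hp. pose proof (par_out a Ha Hr) as Ho.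
  split; [exact Hp|]. split; [now apply par_covers|]. split; [now apply par_pos|].
  split; [reflexivity|]. rewrite <- st_strip, <- st_par. split.
  - apply face_out; auto. now apply ok_st.
  - rewrite <- (out_state_opp _ _ _ (ok_st _ Hp) Ho), strip_norm, par_norm, in_dir_norm. apply face_in.
Qed.

(** The first three strips are complete before the fill starts, so the glue at the end of a row or
    of the trunk points at an occupied cell. *)
Lemma fill_wall s X Y x y : 0 <= X <= 4 * k + 2 -> 0 <= Y < H -> rk s < 3 -> valid (AFill x y) ->
  exists z, valid z /\ pos z = rotp s (X, Y) /\ lt z (AFill x y).
Proof.
  sizes. intros HX HY Hs Hv. destruct (strip_cover s X (Y - depth)) as (z & Hz & Fz & Es & Hp); try lia.
  exists z. split; [auto|]. split; [rewrite Hp; do 2 f_equal; lia|].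
  split; [auto|]. split; [auto|]. destruct z; try discriminate; simpl in Es |- *; subst; left; left; auto.
Qed.

(** A converse of [par_out]. The second alternative occurs only where the fill runs into a wall. *)
Lemma child a e a0 : valid a -> out_state (st a) e = Some a0 ->
  exists z, valid z /\
    ((z <> root /\ parent z = a /\ parent_dir z = e) \/
     (pos z = padd (pos a) (dvec (tdir (adr_strip a) (adr_par a) e)) /\ lt z a)).
Proof.
  sizes. intros Ha E.
  assert (Next : forall z, valid z -> z <> root -> parent z = a -> parent_dir z = e ->
    exists z, valid z /\ ((z <> root /\ parent z = a /\ parent_dir z = e) \/
     (pos z = padd (pos a) (dvec (tdir (adr_strip a) (adr_par a) e)) /\ lt z a))).
  { intros z H1 H2 H3 H4. exists z. auto. }
  destruct a as [s x y|s j c u|s j u|x y].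
  - destruct Ha as [Hx Hy]. destruct e; cbn [st out_state] in E; apply only_some in E as [E _].
    + apply andb_prop in E as [E1 E2]. apply Z.ltb_lt in E2.
      apply (Next (ASeed s x (y + 1))); simpl; try rewrite E1;
        try destruct (Z.eqb_spec (y + 1) (- depth)); try lia; auto.
      * unfold root. intro Q. injection Q as -> -> Q. lia.
      * f_equal; lia.
    + evcase x; rewrite E0 in E.
      * apply andb_prop in E as [E1 E2]. apply Z.eqb_eq in E1.
        destruct (Z.eqb_spec x (4 * k + 2)); [discriminate|].
        assert (Ev : Z.even (x + 1) = false) by (rewrite Z.even_add, E0; reflexivity).
        assert (Et : top (x + 1) = top x) by (apply top_next; auto; zmod).
        apply (Next (ASeed s (x + 1) y)); simpl; rewrite ?Ev, ?Et; try lia.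
        -- unfold root. intro Q. injection Q as Q1 Q2 Q3. lia.
        -- destruct (Z.eqb_spec y (top x)); [f_equal; lia|lia].
        -- destruct (Z.eqb_spec y (top x)); [reflexivity|lia].
      * apply Z.eqb_eq in E. assert (x <> 4 * k + 2) by zmod.
        assert (Ev : Z.even (x + 1) = true) by (rewrite Z.even_add, E0; reflexivity).
        apply (Next (ASeed s (x + 1) y)); simpl; rewrite ?Ev.
        -- tcase (x + 1); lia.
        -- unfold root. intro Q. injection Q as Q1 Q2 Q3. lia.
        -- zbool; try lia. f_equal; lia.
        -- zbool; try lia. reflexivity.
    + apply andb_prop in E as [E1 E2]. destruct (Z.even x) eqn:Ev; [discriminate|].
      destruct (Z.eqb_spec y (- depth)); [discriminate|].
      apply (Next (ASeed s x (y - 1))); simpl; rewrite ?Ev; try lia.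
      * unfold root. intro Q. injection Q as -> -> Q. discriminate.
      * zbool; try lia. f_equal; lia.
      * zbool; try lia. reflexivity.
    + apply andb_prop in E as [E1 E2]. apply Z.eqb_eq in E1, E2. subst.
      apply (Next (ACell s 1 0 U0)); simpl; try reflexivity; vsolve.
  - pose proof Ha as (Hj & Hc & Hu).
    assert (Cl := closing_iff j (c + 1) Hj).
    destruct u, e; cbn [st out_state] in E; try discriminate; try rewrite Cl in E.
    + apply (Next (ACell s j c U1)); simpl; try reflexivity; vsolve.
    + apply (Next (ACell s j c U2)); simpl; try reflexivity; vsolve.
    + destruct (Z.eqb_spec j J); [discriminate|].
      apply (Next (ACell s j c U3)); simpl; try reflexivity; vsolve.
    + destruct (Z.eqb_spec j J); [|discriminate].
      apply (Next (ACell s j c U5)); simpl; zbool; try reflexivity; vsolve.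
    + apply (Next (ACell s j c U4)); simpl; try reflexivity; vsolve.
    + destruct (Z.eqb_spec j J); [discriminate|].
      apply (Next (ACell s j c U5)); simpl; zbool; try reflexivity; vsolve.
    + apply (Next (ACell s j c U6)); simpl; try reflexivity; vsolve.
    + apply (Next (ACell s j c U7)); simpl; try reflexivity; vsolve.
    + destruct (Z.eq_dec c (k - 1)) as [->|].
      * apply (Next (ATurn s j T0)); simpl; try reflexivity; vsolve.
      * apply (Next (ACell s j (c + 1) U0)); simpl; zbool; try reflexivity; vsolve.
        all: f_equal; lia.
  - pose proof Ha as (Hj & H6 & H5). cbn [st] in E.
    assert (Cl := closing_iff j k Hj). assert (Hend := carry_end j Hj).
    destruct u, e; cbn [out_state] in E;
      try (destruct s; discriminate); try (destruct s, (Z.even j); discriminate).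
    + apply (Next (ATurn s j T1)); simpl; try reflexivity; vsolve.
    + apply (Next (ATurn s j T2)); simpl; try reflexivity; vsolve.
    + apply (Next (ATurn s j T3)); simpl; try reflexivity; vsolve.
    + apply (Next (ATurn s j T4)); simpl; try reflexivity; vsolve.
    + destruct (Z.eqb_spec j J) as [->|].
      * assert (Hs : exists s', next_strip s = Some s').
        { destruct s; simpl; eauto. destruct (Z.even J) eqn:Ev; [|rewrite even_J in Ev; discriminate].
          rewrite Cl in E. discriminate. }
        destruct Hs as [s' Hs].
        apply (Next (ASeed s' 0 (- depth))); simpl.
        -- change (top 0) with (-1). lia.
        -- unfold root. intro Q. injection Q as ->. destruct s; discriminate.
        -- zbool; try lia. destruct s; inversion Hs; reflexivity.
        -- zbool; try lia. reflexivity.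
      * apply (Next (ATurn s j T5)); simpl; try reflexivity; vsolve.
    + assert (Q : carry j k = true).
      { destruct (carry j k); auto. destruct s, (Z.even j); discriminate. }
      specialize (H5 eq_refl).
      apply (Next (ATurn s j T6)); simpl; try reflexivity; [|discriminate].
      split; [lia|]. split; [|discriminate]. intros _. rewrite Hend in Q.
      destruct (Z.even j); apply Z.eqb_eq in Q; lia.
    + assert (Q : carry j k = false).
      { destruct (carry j k); auto. destruct s, (Z.even j); discriminate. }
      specialize (H5 eq_refl).
      assert (j <> J - 1).
      { intros ->. rewrite Hend, even_pred, even_J in Q. simpl in Q.
        apply Z.eqb_neq in Q. lia. }
      apply (Next (ACell s (j + 1) 0 U0)); simpl; zbool; try lia; try discriminate; auto.
      f_equal; lia.
    + specialize (H6 (or_introl eq_refl)). subst j. destruct s; try discriminate.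
      apply (Next (AFill w w)); simpl; zbool; try reflexivity; vsolve.
    + specialize (H6 (or_introl eq_refl)). subst j.
      apply (Next (ATurn s (J - 1) T7)); simpl; try reflexivity; vsolve.
    + specialize (H6 (or_intror eq_refl)). subst j.
      apply (Next (ACell s J 0 U0)); simpl; zbool; try reflexivity; vsolve.
  - cbn [st] in E.
    assert (De : e = DE \/ (e = DN /\ x = w)).
    { destruct (Z.eqb_spec x w); destruct e; try discriminate; auto. }
    clear E. simpl in Ha. destruct De as [->|[-> ->]].
    + destruct (Z_lt_le_dec (x + 1) H).
      * apply (Next (AFill (x + 1) y)); simpl; zbool; try reflexivity; vsolve. f_equal; lia.
      * destruct (fill_wall S2 (w - 1) (N - 1 - y) x y) as (z & Hz & Hp & Hl); simpl; try lia.
        exists z. split; [auto|]. right. split; [|auto]. rewrite Hp, pos_fill.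
        unfold padd; simpl. f_equal; lia.
    + destruct (Z_lt_le_dec (y + 1) H).
      * apply (Next (AFill w (y + 1))); simpl; zbool; try reflexivity; vsolve. f_equal; lia.
      * destruct (fill_wall S1 (w - 1) w w y) as (z & Hz & Hp & Hl); simpl; try lia.
        exists z. split; [auto|]. right. split; [|auto]. rewrite Hp, pos_fill.
        unfold padd; simpl. f_equal; lia.
Qed.

Definition strips : list strip := [S0; S1; S2; S3].
Definition bools : list bool := [true; false].
Definition body_cells : list body_cell := [U0; U1; U2; U3; U4; U5; U6; U7].
Definition turn_cells : list turn_cell := [T0; T1; T2; T3; T4; T5; T6; T7].

Definition seed_states : list state :=
  filter (fun a => match a with Seed _ x y => y <=? top x | _ => true end)
    (map (fun '(s, (x, y)) => Seed s x y)
      (list_prod strips (list_prod (zrange 0 (4 * k + 3)) (zrange (- depth) (depth + 2))))).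

Definition states : list state :=
  seed_states ++
  map (fun '(s, (p, (q, v))) => Entry s p q v)
    (list_prod strips (list_prod bools (list_prod bools bools))) ++
  map (fun '(s, (p, (u, (q, (d, (bl, br)))))) => Body s p u q d bl br)
    (list_prod strips (list_prod bools (list_prod body_cells (list_prod bools
      (list_prod (zrange 0 b) (list_prod bools bools)))))) ++
  map (fun '(s, (p, (q, l))) => Exit s p q l)
    (list_prod strips (list_prod bools (list_prod bools bools))) ++
  map (fun '(s, (p, (u, q))) => Turn s p u q)
    (list_prod strips (list_prod bools (list_prod turn_cells bools))) ++
  [Trunk; Row].

Lemma in_strips s : In s strips.
Proof. destruct s; simpl; auto. Qed.

Lemma in_bools q : In q bools.
Proof. destruct q; simpl; auto. Qed.

Lemma in_body_cells u : In u body_cells.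
Proof. destruct u; simpl; tauto. Qed.

Lemma in_turn_cells u : In u turn_cells.
Proof. destruct u; simpl; tauto. Qed.

Lemma in_seed_states s x y : 0 <= x <= 4 * k + 2 -> - depth <= y <= top x -> In (Seed s x y) seed_states.
Proof.
  intros Hx Hy. apply filter_In. split; [|apply Z.leb_le; lia].
  apply in_map_iff. exists (s, (x, y)). split; [reflexivity|].
  apply in_prod; [apply in_strips|].
  apply in_prod; apply zrange_in; tcase x; lia.
Qed.

Lemma states_ok a : In a states -> ok a.
Proof.
  intro Ha. destruct a as [s x y|s p q v|s p u q d bl br|s p q l|s p u q| |]; simpl; auto.
  assert (Hs : In (Seed s x y) seed_states).
  { unfold states in Ha. apply in_app_or in Ha as [Ha|Ha]; auto. exfalso.
    repeat (apply in_app_or in Ha as [Ha|Ha]);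
      try (apply in_map_iff in Ha as (t & Ht & _); repeat destruct t as [? t]; discriminate).
    destruct Ha as [Ha|[Ha|[]]]; discriminate. }
  apply filter_In in Hs as [Hs Ht]. apply Z.leb_le in Ht.
  apply in_map_iff in Hs as ([s' [x' y']] & E & Hs). injection E as <- <- <-.
  apply in_prod_iff in Hs as [_ Hs]. apply in_prod_iff in Hs as [Hx Hy].
  apply zrange_in in Hx, Hy. lia.
Qed.

Lemma in_states_ce s p q v : In (Entry s p q v) states.
Proof.
  unfold states. apply in_or_app. right. apply in_or_app. left. apply in_map_iff.
  exists (s, (p, (q, v))). split; auto.
  repeat apply in_prod; auto using in_strips, in_bools.
Qed.

Lemma in_states_cb s p u q d bl br : 0 <= d < b -> In (Body s p u q d bl br) states.
Proof.
  intro Hd. unfold states. do 2 (apply in_or_app; right). apply in_or_app. left. apply in_map_iff.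
  exists (s, (p, (u, (q, (d, (bl, br)))))). split; auto.
  repeat apply in_prod; auto using in_strips, in_bools, in_body_cells. apply zrange_in. lia.
Qed.

Lemma in_states_cf s p q l : In (Exit s p q l) states.
Proof.
  unfold states. do 3 (apply in_or_app; right). apply in_or_app. left. apply in_map_iff.
  exists (s, (p, (q, l))). split; auto.
  repeat apply in_prod; auto using in_strips, in_bools.
Qed.

Lemma in_states_tn s p u q : In (Turn s p u q) states.
Proof.
  unfold states. do 4 (apply in_or_app; right). apply in_or_app. left. apply in_map_iff.
  exists (s, (p, (u, q))). split; auto.
  repeat apply in_prod; auto using in_strips, in_bools, in_turn_cells.
Qed.

Lemma in_states_fill a : a = Trunk \/ a = Row -> In a states.
Proof.
  intros Ha. unfold states. do 5 (apply in_or_app; right). destruct Ha; subst; simpl; auto.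
Qed.

Lemma st_states a : valid a -> In (st a) states.
Proof.
  intro Ha. destruct a as [s x y|s j c u|s j u|x y]; simpl in *.
  - unfold states. apply in_or_app. left. now apply in_seed_states.
  - destruct u; auto using in_states_ce, in_states_cf, in_states_cb, digit_range.
  - apply in_states_tn.
  - apply in_states_fill. destruct (x =? w); auto.
Qed.

(** * Reading a digit behind its guard *)

(** The pass below ran the other way, so it met the digit at place [k - 1 - c]; for [j = 1] that
    pass is the first row. *)
Definition guard (s : strip) (j c : Z) : address :=
  if j =? 1 then ASeed s (4 * (k - 1 - c) + 3) 1 else ACell s (j - 1) (k - 1 - c) U4.

Definition source (s : strip) (j c : Z) : address :=
  if j =? 1 then ASeed s (4 * (k - 1 - c) + 4) 0 else ACell s (j - 1) (k - 1 - c) U6.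

Definition digit_label (s : strip) (j c : Z) : label :=
  Digit s (Z.even j) (digit (value (j - 1)) (digit_index j c))
    (digit_index j c =? 0) (digit_index j c =? k - 1).

Lemma top_mod x r : 2 <= x -> x mod 4 = r -> top x = if r <? 2 then 0 else 1.
Proof. intros Hx Hr. unfold top. destruct (Z.ltb_spec x 2); [lia|]. now rewrite Hr. Qed.

Lemma value_0 : value 0 = V0.
Proof. unfold value. change ((0 + 1) / 2) with 0. lia. Qed.

(** Collects what the growth conditions need about a pit. The decisive order is [lt g d]: no digit
    is ever visible without its guard. *)
Lemma reader_env s j c : valid (ACell s j c U1) ->
  let z := ACell s j c U1 in let g := guard s j c in let d := source s j c in
  valid g /\ valid d /\ lt g z /\ lt d z /\ lt g d /\
  pos g = padd (pos z) (dvec (tdir s (Z.even j) DE)) /\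
  pos d = padd (pos z) (dvec (tdir s (Z.even j) DS)) /\
  face_of (st g) (dopp (tdir s (Z.even j) DE)) = Neg /\
  face_of (st d) (dopp (tdir s (Z.even j) DS)) = Lab (digit_label s j c).
Proof.
  sizes. intros Hz. cbv zeta. pose proof Hz as (Hj & Hc & _). unfold guard, source.
  destruct (Z.eqb_spec j 1) as [->|Hj1].
  - assert (M3 : (4 * (k - 1 - c) + 3) mod 4 = 3) by zmod.
    assert (M0 : (4 * (k - 1 - c) + 4) mod 4 = 0) by zmod.
    assert (T3 : top (4 * (k - 1 - c) + 3) = 1) by (rewrite (top_mod _ 3); auto; lia).
    assert (T0 : top (4 * (k - 1 - c) + 4) = 0) by (rewrite (top_mod _ 0); auto; lia).
    assert (Vg : valid (ASeed s (4 * (k - 1 - c) + 3) 1)) by (simpl; rewrite T3; lia).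
    assert (Vd : valid (ASeed s (4 * (k - 1 - c) + 4) 0)) by (simpl; rewrite T0; lia).
    split; [exact Vg|]. split; [exact Vd|].
    split; [split; [exact Vg|]; split; [exact Hz|]; simpl; lia|].
    split; [split; [exact Vd|]; split; [exact Hz|]; simpl; lia|].
    split; [split; [exact Vg|]; split; [exact Vd|]; simpl; lia|].
    change (Z.even 1) with false.
    split; [unfold pos; simpl; rewrite <- pos_step; unfold frame, padd; simpl; do 2 f_equal; lia|].
    split; [unfold pos; simpl; rewrite <- pos_step; unfold frame, padd; simpl; do 2 f_equal; lia|].
    assert (E3 : Z.even (4 * (k - 1 - c) + 3) = false)
      by (evcase (4 * (k - 1 - c) + 3); auto; zmod).
    assert (E0 : Z.even (4 * (k - 1 - c) + 4) = true)
      by (evcase (4 * (k - 1 - c) + 4); auto; zmod).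
    assert (G : cface (Seed s (4 * (k - 1 - c) + 3) 1) DE = Neg).
    { unfold cface. simpl. rewrite E3, T3, M3. simpl.
      destruct (dir_eq_dec DE DW); [discriminate|].
      destruct (Z.eqb_spec 1 (- depth)); [lia|reflexivity]. }
    assert (D : cface (Seed s (4 * (k - 1 - c) + 4) 0) DN = Lab (digit_label s 1 c)).
    { unfold cface. simpl. rewrite E0, T0, M0. simpl.
      replace (0 <? 4 * (k - 1 - c) + 4) with true by (symmetry; apply Z.ltb_lt; lia).
      replace ((4 * (k - 1 - c) + 4) / 4) with (k - c) by zmod.
      replace (k - (k - c)) with c by lia.
      destruct (Z.eqb_spec 0 (- depth)); [lia|].
      change (0 <? 0) with false. simpl.
      unfold digit_label. change (1 - 1) with 0. rewrite value_0.
      unfold digit_index. change (Z.even 1) with false. reflexivity. }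
    rewrite <- G, <- D, <- !face_of_tdir. simpl st. split; now destruct s.
  - assert (Vg : valid (ACell s (j - 1) (k - 1 - c) U4)) by (simpl; vsolve).
    assert (Vd : valid (ACell s (j - 1) (k - 1 - c) U6)) by (simpl; vsolve).
    split; [exact Vg|]. split; [exact Vd|].
    split; [split; [exact Vg|]; split; [exact Hz|]; simpl; lia|].
    split; [split; [exact Vd|]; split; [exact Hz|]; simpl; lia|].
    split; [split; [exact Vg|]; split; [exact Vd|]; simpl; lia|].
    assert (Ev : Z.even (j - 1) = negb (Z.even j)) by apply even_pred.
    split; [unfold pos; simpl adr_strip; simpl adr_par; rewrite <- pos_step, Ev; unfold frame, padd;
      destruct (Z.even j); simpl; do 2 f_equal; lia|].
    split; [unfold pos; simpl adr_strip; simpl adr_par; rewrite <- pos_step, Ev; unfold frame, padd;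
      destruct (Z.even j); simpl; do 2 f_equal; lia|].
    assert (Cl : negb (Z.even j) && carry (j - 1) (k - 1 - c + 1) = false).
    { rewrite <- Ev, closing_iff by lia. apply Z.eqb_neq. lia. }
    assert (Dp : digit_index (j - 1) (k - 1 - c) = digit_index j c).
    { unfold digit_index. rewrite Ev. destruct (Z.even j); simpl; lia. }
    simpl st. rewrite Ev, Dp. unfold digit_label.
    split; unfold face_of; simpl state_strip; simpl state_par.
    + destruct s, (Z.even j); reflexivity.
    + destruct s, (Z.even j); unfold cface; simpl in *; rewrite ?Cl; reflexivity.
Qed.

Lemma reader_faces s j c :
  face_of (st (ACell s j c U1)) (tdir s (Z.even j) DE) = Neg /\
  face_of (st (ACell s j c U1)) (tdir s (Z.even j) DS) = Lab (digit_label s j c).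
Proof. simpl. unfold face_of. simpl. rewrite !itdir_tdir. split; reflexivity. Qed.

Lemma neg_inv a e : valid a -> neg_on (st a) e = true -> e = DE /\
  ((exists s j c, a = ACell s j c U1) \/ (exists s j c, valid (ACell s j c U1) /\ a = guard s j c)).
Proof.
  sizes. intros Ha E. destruct a as [s x y|s j c u|s j u|x y]; simpl in E.
  - destruct e; try discriminate. split; auto. right.
    apply andb_prop in E as [E1 E2]. apply Z.eqb_eq in E1, E2. destruct Ha as [Hx Hy].
    exists s, 1, (k - 1 - x / 4). unfold guard. simpl. subst y. split.
    + tcase x; vsolve; zmod.
    + f_equal. zmod.
  - destruct Ha as (Hj & Hc & Hu).
    destruct u; try discriminate; destruct e; try discriminate; (split; [reflexivity|]).
    + left. eauto.
    + right. exists s, (j + 1), (k - 1 - c).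
      assert (j <> J) by (intro Q; destruct (Hu Q); congruence).
      unfold guard. split; [simpl; vsolve|].
      destruct (Z.eqb_spec (j + 1) 1); [lia|]. f_equal; lia.
  - discriminate.
  - destruct (x =? w); discriminate.
Qed.

Lemma data_inv a e l : valid a -> data_on (st a) e = Some l ->
  (e = DS /\ exists s j c, a = ACell s j c U1 /\ l = digit_label s j c) \/
  (e = DN /\ exists s j c, valid (ACell s j c U1) /\ a = source s j c).
Proof.
  sizes. intros Ha E. destruct a as [s x y|s j c u|s j u|x y]; cbn [st] in E.
  - simpl in E. destruct e; try discriminate. right. split; auto.
    destruct ((x mod 4 =? 0) && (0 <? x) && (y =? 0)) eqn:Q; [|discriminate].
    apply andb_prop in Q as [Q E3]. apply andb_prop in Q as [E1 E2].
    apply Z.eqb_eq in E1, E3. apply Z.ltb_lt in E2. destruct Ha as [Hx Hy].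
    exists s, 1, (k - x / 4). unfold source. simpl. subst y. split.
    + vsolve; zmod.
    + f_equal. zmod.
  - destruct Ha as (Hj & Hc & Hu).
    destruct u; try discriminate; destruct e; try discriminate; cbn [data_on] in E.
    + left. split; auto. exists s, j, c. split; auto. now injection E as <-.
    + right. split; auto. rewrite closing_iff in E by lia.
      destruct (Z.eqb_spec j J); [discriminate|].
      exists s, (j + 1), (k - 1 - c). unfold source. split; [simpl; vsolve|].
      destruct (Z.eqb_spec (j + 1) 1); [lia|]. f_equal; lia.
  - discriminate.
  - destruct (x =? w); discriminate.
Qed.

Lemma data_on_inv a e s p d bl br : data_on a e = Some (Digit s p d bl br) ->
  (e = DS /\ exists q, a = Body s p U1 q d bl br) \/ (e = DN /\ state_strip a = s).
Proof.
  intro E. destruct a as [s' x y|s' p' q v|s' p' u q d' bl' br'|s' p' q l|s' p' u q| |]; simpl in E;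
    try discriminate.
  - destruct e; try discriminate. right. split; auto.
    destruct ((x mod 4 =? 0) && (0 <? x) && (y =? 0)); [|discriminate].
    now injection E as <- _ _ _ _.
  - destruct u; try discriminate; destruct e; try discriminate.
    + left. split; auto. injection E as <- <- <- <- <-. eauto.
    + right. split; auto. destruct (p' && q); [discriminate|]. now injection E as <- _ _ _ _.
Qed.

(** The label is an input or an output of either tile. Two inputs or two outputs would make [d] its
    own opposite; an input of [a] points at its parent, which is in place; an output of [a] leads to
    [child]. *)
Lemma edge_spec a t d l : valid a -> In t states -> is_edge l = true ->
  face_of (st a) d = Lab l -> face_of t (dopp d) = Lab l ->
  exists z, valid z /\ pos z = padd (pos a) (dvec d) /\
    (lt z a \/ (covers address valid lt a z /\
      (t = st z \/ reads state address label is_edge face_of valid pos st lt z t (dopp d)))).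
Proof.
  intros Ha Ht El F1 F2. destruct l as [a0|]; [clear El|discriminate].
  pose proof (states_ok t Ht) as Ot. pose proof (ok_st a Ha) as Oa.
  set (e1 := itdir (state_strip (st a)) (state_par (st a)) d).
  set (e2 := itdir (state_strip t) (state_par t) (dopp d)).
  assert (D1 : d = tdir (state_strip (st a)) (state_par (st a)) e1)
    by (unfold e1; now rewrite tdir_itdir).
  assert (D2 : dopp d = tdir (state_strip t) (state_par t) e2)
    by (unfold e2; now rewrite tdir_itdir).
  rewrite D1, face_of_tdir in F1. rewrite D2, face_of_tdir in F2.
  apply cface_edge in F1. apply cface_edge in F2.
  destruct F1 as [[C1 N1]|P1], F2 as [[C2 N2]|P2].
  - exfalso. apply (dopp_neq d). rewrite D2, D1 at 1. rewrite C1, C2.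
    rewrite <- (in_dir_norm t), <- (strip_norm t), <- (par_norm t), <- N2, N1.
    now rewrite in_dir_norm, strip_norm, par_norm.
  - destruct (classic (a = root)) as [->|Hr].
    (* The input side of the root shows a glue too, but no rule hands on the state of the root. *)
    + exfalso. simpl in N1. subst a0.
      destruct t as [s x y|s p q v|s p u q d' bl br|s p q l|s p u q| |].
      * destruct Ot as [Hx Hy].
        destruct e2; cbn [out_state] in P2; apply only_some in P2 as [Q P2]; try discriminate;
          injection P2 as Q1 Q2 Q3; try lia.
        subst x. discriminate.
      * destruct e2; discriminate.
      * destruct u, e2; simpl in P2; try discriminate;
          try (destruct (p && q); discriminate).
        destruct (advance p q d'); discriminate.
      * destruct e2; try discriminate. destruct l; discriminate.
      * destruct u, e2, s, p, q; discriminate.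
      * destruct e2; discriminate.
      * destruct e2; discriminate.
    + exists (parent a). pose proof (par_valid a Ha Hr) as Hp. split; [auto|].
      split; [|left; apply (par_covers a Ha Hr)].
      pose proof (par_pos a Ha Hr) as Hpos. apply padd_dopp_swap in Hpos. rewrite Hpos.
      do 2 f_equal. rewrite D1, C1.
      rewrite <- (in_dir_norm (st a)), <- (strip_norm (st a)), <- (par_norm (st a)).
      rewrite (out_state_opp _ _ _ (ok_st _ Hp) (par_out a Ha Hr)).
      now rewrite st_strip, st_par.
  - destruct (child a e1 a0 Ha P1) as (z & Hz & [(Hr & Hpz & Hdz)|[Hpz Hlt]]).
    2:{ exists z. split; [auto|]. split; [|auto]. now rewrite Hpz, D1, st_strip, st_par. }
    exists z. split; [auto|].
    pose proof (par_pos z Hz Hr) as Hpos. pose proof (par_out z Hz Hr) as Ho.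
    rewrite Hpz, Hdz in Hpos, Ho.
    split; [now rewrite Hpos, D1, st_strip, st_par|]. right.
    split; [rewrite <- Hpz; now apply par_covers|].
    assert (Nz : norm t = norm (st z)) by congruence.
    destruct z as [s x y|s j c u|s j u|x y];
      [left; now destruct t as [| |? ? []| | | |]| |left; now destruct t as [| |? ? []| | | |]|
       left; simpl in Nz |- *; destruct (x =? w); now destruct t as [| |? ? []| | | |]].
    destruct u; try (left; now destruct t as [| |? ? []| | | |]).
    (* The bond leaves the digit of a reader open. The only data side of [t] faces [source], which
       shows the right digit. *)
    right. simpl in Nz.
    destruct t as [| |s' p' u' q' d' bl' br'| | | |]; try discriminate.
    destruct u'; try discriminate. injection Nz as -> -> ->.
    destruct (reader_env s j c Hz) as (Vg & Vd & Lg & Ld & _ & Pg & Pd & Fg & Fd).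
    exists (tdir s (Z.even j) DE), (guard s j c).
    split.
    { rewrite D2, C2. simpl. destruct s, (Z.even j); discriminate. }
    split; [auto|]. split; [auto|]. split; [auto|]. split; [auto|].
    split; [unfold face_of; simpl; now rewrite itdir_tdir|].
    intros e a' l Ha' Hpa' El G1 G2.
    assert (De : e = tdir s (Z.even j) DS).
    { rewrite <- (tdir_itdir s (Z.even j) e). unfold face_of in G1. simpl in G1.
      apply cface_data in G1; auto.
      destruct (itdir s (Z.even j) e); simpl in G1; congruence. }
    subst e.
    assert (a' = source s j c) by (apply pos_inj; congruence). subst a'.
    rewrite Fd in G2. injection G2 as <-.
    unfold face_of in G1. simpl in G1. rewrite itdir_tdir in G1.
    apply cface_data in G1; auto. simpl in G1. injection G1 as -> -> ->. reflexivity.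
  - exfalso. pose proof (out_state_opp _ _ _ Oa P1) as Q1. pose proof (out_state_opp _ _ _ Ot P2) as Q2.
    rewrite <- D1 in Q1. rewrite <- D2 in Q2. rewrite Q1 in Q2.
    rewrite dopp_involutive in Q2. now apply (dopp_neq d).
Qed.

(** Seen from a reader, the source is already there. Seen from a source, the partner is a reader
    facing the guard: another writer of the same strip would show the label on the same absolute
    side, as mirroring fixes north and south. *)
Lemma data_spec a t d l : valid a -> In t states -> is_edge l = false ->
  face_of (st a) d = Lab l -> face_of t (dopp d) = Lab l ->
  (exists z, valid z /\ pos z = padd (pos a) (dvec d) /\ lt z a) \/
  (exists g dg, valid g /\ lt g a /\ pos g = padd (padd (pos a) (dvec d)) (dvec dg) /\
     face_of (st g) (dopp dg) = Neg /\ face_of t dg = Neg /\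
     forall e l', face_of t e = Lab l' -> is_edge l' = false -> e = dopp d).
Proof.
  intros Ha Ht El F1 F2.
  set (e1 := itdir (state_strip (st a)) (state_par (st a)) d).
  set (e2 := itdir (state_strip t) (state_par t) (dopp d)).
  assert (D1 : d = tdir (state_strip (st a)) (state_par (st a)) e1)
    by (unfold e1; now rewrite tdir_itdir).
  assert (D2 : dopp d = tdir (state_strip t) (state_par t) e2)
    by (unfold e2; now rewrite tdir_itdir).
  unfold face_of in F1, F2. fold e1 in F1. fold e2 in F2.
  apply cface_data in F1; auto. apply cface_data in F2; auto.
  destruct l as [|s0 p0 d0 bl0 br0]; [discriminate|].
  rewrite st_strip, st_par in D1.
  destruct (data_inv a e1 _ Ha F1) as [(E1 & s & j & c & -> & Hl)|(E1 & s & j & c & Hz & ->)].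
  - left. destruct (reader_env s j c Ha) as (Vg & Vd & Lg & Ld & _ & Pg & Pd & _).
    exists (source s j c). split; [auto|]. split; [|auto]. now rewrite Pd, D1, E1.
  - right. destruct (reader_env s j c Hz) as (Vg & Vd & Lg & Ld & Lgd & Pg & Pd & Fg & Fd).
    assert (Str : adr_strip (source s j c) = s)
      by (unfold source; destruct (j =? 1); reflexivity).
    assert (Hd : d = dopp (tdir s (Z.even j) DS)).
    { rewrite D1, E1, Str. now destruct (adr_par (source s j c)), (Z.even j), s. }
    assert (Hl : digit_label s j c = Digit s0 p0 d0 bl0 br0).
    { rewrite <- Hd in Fd. unfold face_of in Fd. fold e1 in Fd.
      apply cface_data in Fd; [congruence|reflexivity]. }
    injection Hl as Es Ep _ _ _. subst s0 p0.
    destruct (data_on_inv t e2 _ _ _ _ _ F2) as [(E2 & q & ->)|(E2 & Hs)].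
    + exists (guard s j c), (tdir s (Z.even j) DE). split; [auto|]. split; [auto|].
      split; [rewrite Pg, Pd, Hd, padd_dopp; reflexivity|]. split; [auto|].
      split; [unfold face_of; simpl; now rewrite itdir_tdir|].
      intros e l' G1 El'. rewrite Hd, dopp_involutive.
      rewrite <- (tdir_itdir s (Z.even j) e). unfold face_of in G1. simpl in G1.
      apply cface_data in G1; auto.
      destruct (itdir s (Z.even j) e); simpl in G1; congruence.
    + exfalso. rewrite Hd, E2, Hs in D2.
      destruct s, (Z.even j), (state_par t); discriminate.
Qed.

Lemma neg_spec a : valid a -> a <> root ->
  (forall e, face_of (st a) e = Neg ->
     exists r, valid r /\ pos r = padd (pos a) (dvec e) /\ lt a r) \/
  (exists dg dd q l, (forall e, face_of (st a) e = Neg -> e = dg) /\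
     valid q /\ lt q a /\ pos q = padd (pos a) (dvec dd) /\ is_edge l = false /\
     face_of (st a) dd = Lab l /\ face_of (st q) (dopp dd) = Lab l).
Proof.
  intros Ha _.
  assert (Hneg : forall e, face_of (st a) e = Neg ->
    e = tdir (adr_strip a) (adr_par a) DE /\
    ((exists s j c, a = ACell s j c U1) \/ (exists s j c, valid (ACell s j c U1) /\ a = guard s j c))).
  { intros e He. unfold face_of in He. apply cface_neg in He.
    destruct (neg_inv _ _ Ha He) as [E Hc]. split; auto.
    now rewrite <- E, <- st_strip, <- st_par, tdir_itdir. }
  destruct (classic (exists s j c, a = ACell s j c U1)) as [(s & j & c & ->)|Hno].
  - right. destruct (reader_env s j c Ha) as (Vg & Vd & Lg & Ld & _ & Pg & Pd & Fg & Fd).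
    exists (tdir s (Z.even j) DE), (tdir s (Z.even j) DS), (source s j c), (digit_label s j c).
    split; [intros e He; apply (Hneg e He)|].
    split; [auto|]. split; [auto|]. split; [auto|]. split; [reflexivity|].
    split; [apply reader_faces|auto].
  - left. intros e He. destruct (Hneg e He) as [E [Hc|(s & j & c & Hz & ->)]]; [now elim Hno|].
    destruct (reader_env s j c Hz) as (Vg & Vd & Lg & Ld & _ & Pg & Pd & Fg & Fd).
    exists (ACell s j c U1). split; [auto|]. split; [|auto].
    rewrite Pg, E.
    replace (tdir (adr_strip (guard s j c)) (adr_par (guard s j c)) DE)
      with (dopp (tdir s (Z.even j) DE)); [now rewrite padd_dopp|].
    unfold guard. destruct (Z.eqb_spec j 1) as [->|]; simpl.
    + now destruct s.
    + rewrite even_pred. now destruct s, (Z.even j).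
Qed.

(** * Coding the labels and counting the tiles *)

Definition state_list (a : state) : list Z :=
  match a with
  | Seed s x y => [0; rk s; x; y]
  | Entry s p q v => [1; rk s; Z.b2z p; Z.b2z q; Z.b2z v]
  | Body s p u q d bl br => [2; rk s; Z.b2z p; rku u; Z.b2z q; d; Z.b2z bl; Z.b2z br]
  | Exit s p q l => [3; rk s; Z.b2z p; Z.b2z q; Z.b2z l]
  | Turn s p u q => [4; rk s; Z.b2z p; rkt u; Z.b2z q]
  | Trunk => [5]
  | Row => [6]
  end.

Definition label_code (l : label) : nat :=
  match l with
  | Bond a => lcode (0 :: state_list a)
  | Digit s p d bl br => lcode [1; rk s; Z.b2z p; d; Z.b2z bl; Z.b2z br]
  end.

Lemma b2z_inj p q : Z.b2z p = Z.b2z q -> p = q.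
Proof. destruct p, q; simpl; intro; try reflexivity; discriminate. Qed.

Lemma state_list_inj a a' : state_list a = state_list a' -> a = a'.
Proof.
  destruct a, a'; simpl; intro E; try discriminate; try reflexivity; injection E; intros;
    f_equal; auto using rk_inj, rku_inj, rkt_inj, b2z_inj.
Qed.

Lemma label_code_inj l l' : label_code l = label_code l' -> l = l'.
Proof.
  destruct l, l'; unfold label_code; intro E; apply lcode_inj in E; try discriminate.
  - injection E as E. f_equal. now apply state_list_inj.
  - injection E; intros. f_equal; auto using rk_inj, b2z_inj.
Qed.

Lemma root_valid : valid root.
Proof. simpl. change (top 0) with (-1). lia. Qed.

(** The body states give [512 = 4 * 2 * 8 * 2 * 4] per digit value; [194] is the sum of 32 entries,
    32 exits, 128 turns and the two states of the fill. *)
Lemma states_length : Z.of_nat (length states) <= 4 * (4 * k + 3) * (depth + 2) + 512 * b + 194.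
Proof.
  assert (Hs : (length seed_states <=
     4 * (Z.to_nat (4 * k + 3) * Z.to_nat (depth + 2)))%nat).
  { unfold seed_states. etransitivity; [apply filter_length_le|].
    rewrite length_map, !length_prod, !zrange_length. reflexivity. }
  unfold states. rewrite !length_app, !length_map, !length_prod, !zrange_length.
  simpl length. nia.
Qed.

Theorem pinwheel :
  exists (T : list tile) (s0 : tile) (p : zpos),
    NoDup T /\ In s0 T /\ glue_restricted T /\
    directed T 1 (single_seed s0 p) /\
    strictly_self_assembles T 1 (single_seed s0 p) (square N) /\
    Z.of_nat (length T) <= 4 * (4 * k + 3) * (depth + 2) + 512 * b + 194.
Proof.
  exists (tile_set state label label_code face_of states),
    (state_tile state label label_code face_of (st root)), (pos root).
  split; [apply NoDup_nodup|].
  split.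
  { apply (root_in_tile_set state address label label_code face_of states valid st root);
      [apply root_valid|apply st_states]. }
  split.
  { apply (tile_set_restricted state label label_code face_of states
      (Body S0 false U4 false 0 false false) DE);
      [apply in_states_cb; lia|reflexivity]. }
  assert (G := growth_theorem state address label label_code is_edge face_of states valid pos st lt root
    label_code_inj root_valid root_lowest st_states pos_inj lt_wf parent_spec edge_spec data_spec
    neg_spec (square N) (list_prod (zrange 0 N) (zrange 0 N)) pos_square).
  destruct G as [G1 G2].
  { intros [x y] [Hx Hy]. simpl in Hx, Hy. apply in_prod; apply zrange_in; lia. }
  split; [exact G1|]. split; [exact G2|].
  pose proof states_length.
  pose proof (tile_set_length state label label_code face_of states). lia.
Qed.

End Pinwheel.

(** * Small squares *)

Section Comb.

Variable N : Z.
Hypothesis N_pos : 1 <= N.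

Definition comb_valid (a : zpos) : Prop := 0 <= fst a < N /\ 0 <= snd a < N.

(** Each label is the address of the cell it leads to. The west side of the origin is negative
    because a glue restricted tile set must contain such a glue; it faces out of the square. *)
Definition comb_face (a : zpos) (d : dir) : face zpos :=
  let (x, y) := a in
  match d with
  | DN => if (x =? 0) && (y + 1 <? N) then Lab (0, y + 1) else Null
  | DE => if x + 1 <? N then Lab (x + 1, y) else Null
  | DS => if (x =? 0) && (0 <? y) then Lab (0, y) else Null
  | DW => if 0 <? x then Lab (x, y) else if y =? 0 then Neg else Null
  end.

Definition comb_lt (a a' : zpos) : Prop :=
  comb_valid a /\ comb_valid a' /\
  ((snd a = snd a' /\ fst a < fst a') \/ (fst a = 0 /\ snd a < snd a')).

Definition comb_code (a : zpos) : nat := lcode [fst a; snd a].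

Definition comb_states : list zpos := list_prod (zrange 0 N) (zrange 0 N).

Lemma comb_states_in a : In a comb_states <-> comb_valid a.
Proof.
  destruct a as [x y]. unfold comb_states, comb_valid, zpos.
  rewrite in_prod_iff, !zrange_in. simpl. lia.
Qed.

Lemma comb_lt_wf : well_founded comb_lt.
Proof.
  apply wf_incl with (fun a a' => (Z.to_nat (fst a + snd a) < Z.to_nat (fst a' + snd a'))%nat).
  - intros a a' (Ha & Ha' & Hl). unfold comb_valid in *. lia.
  - apply (wf_inverse_image zpos nat Nat.lt (fun a => Z.to_nat (fst a + snd a))), Nat.lt_wf_0.
Qed.

Lemma comb_covers_up y : 0 <= y -> y + 1 < N ->
  covers zpos comb_valid comb_lt (0, y) (0, y + 1).
Proof.
  intros Hy Hn. unfold covers, comb_lt, comb_valid. simpl. split; [lia|].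
  intros [u v] Hv Hl. simpl in *. destruct (Z.eq_dec v y); [left; f_equal; lia|right; lia].
Qed.

Lemma comb_covers_right x y : 0 <= x -> x + 1 < N -> 0 <= y < N ->
  covers zpos comb_valid comb_lt (x, y) (x + 1, y).
Proof.
  intros Hx Hn Hy. unfold covers, comb_lt, comb_valid. simpl. split; [lia|].
  intros [u v] Hv Hl. simpl in *.
  destruct (Z.eq_dec v y), (Z.eq_dec u x); [left; f_equal; lia|right; lia..].
Qed.

Lemma comb_parent a : comb_valid a -> a <> (0, 0) ->
  exists p d l, comb_valid p /\ covers zpos comb_valid comb_lt p a /\
    a = padd p (dvec d) /\ true = true /\ comb_face p d = Lab l /\ comb_face a (dopp d) = Lab l.
Proof.
  destruct a as [x y]. intros [Hx Hy] Hr. simpl in Hx, Hy.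
  destruct (Z.eq_dec x 0) as [->|Hx0].
  - assert (Hy0 : y <> 0) by congruence.
    exists (0, y - 1), DN, (0, y).
    split; [unfold comb_valid; simpl; lia|].
    split; [replace y with (y - 1 + 1) at 2 by lia; apply comb_covers_up; lia|].
    split; [unfold padd; simpl; f_equal; lia|]. split; [reflexivity|]. simpl.
    destruct (Z.ltb_spec (y - 1 + 1) N), (Z.ltb_spec 0 y); try lia.
    simpl. split; do 2 f_equal; lia.
  - exists (x - 1, y), DE, (x, y).
    split; [unfold comb_valid; simpl; lia|].
    split; [replace x with (x - 1 + 1) at 2 by lia; apply comb_covers_right; lia|].
    split; [unfold padd; simpl; f_equal; lia|]. split; [reflexivity|]. simpl.
    destruct (Z.ltb_spec (x - 1 + 1) N), (Z.ltb_spec 0 x); try lia.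
    split; do 2 f_equal; lia.
Qed.

Lemma comb_edge a s d l : comb_valid a -> comb_valid s ->
  comb_face a d = Lab l -> comb_face s (dopp d) = Lab l ->
  s = padd a (dvec d) /\ (comb_lt s a \/ covers zpos comb_valid comb_lt a s).
Proof.
  destruct a as [x y], s as [u v]. intros Ha Hs F1 F2.
  assert (Va := Ha). assert (Vs := Hs). destruct Va, Vs.
  unfold padd. destruct d; simpl in *.
  - destruct ((x =? 0) && (y + 1 <? N)) eqn:E1; [|discriminate].
    destruct ((u =? 0) && (0 <? v)) eqn:E2; [|discriminate].
    apply andb_prop in E1 as [E1 _], E2 as [E2 _]. apply Z.eqb_eq in E1, E2.
    assert (v = y + 1) by congruence. subst.
    split; [reflexivity|]. right. apply comb_covers_up; lia.
  - destruct (Z.ltb_spec (x + 1) N); [|discriminate]. destruct (Z.ltb_spec 0 u).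
    2:{ destruct (v =? 0); discriminate. }
    assert (u = x + 1) by congruence. assert (v = y) by congruence. subst.
    split; [f_equal; lia|]. right. apply comb_covers_right; lia.
  - destruct ((x =? 0) && (0 <? y)) eqn:E1; [|discriminate].
    destruct ((u =? 0) && (v + 1 <? N)) eqn:E2; [|discriminate].
    apply andb_prop in E1 as [E1 _], E2 as [E2 _]. apply Z.eqb_eq in E1, E2.
    assert (v + 1 = y) by congruence. subst. split; [f_equal; lia|].
    left. split; [auto|]. split; [auto|]. simpl. lia.
  - destruct (Z.ltb_spec 0 x). 2:{ destruct (y =? 0); discriminate. }
    destruct (u + 1 <? N); [|discriminate].
    assert (u + 1 = x) by congruence. assert (v = y) by congruence. subst.
    split; [f_equal; lia|]. left. split; [auto|]. split; [auto|]. simpl. lia.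
Qed.

Theorem comb :
  exists (T : list tile) (s0 : tile) (p : zpos),
    NoDup T /\ In s0 T /\ glue_restricted T /\
    directed T 1 (single_seed s0 p) /\
    strictly_self_assembles T 1 (single_seed s0 p) (square N) /\
    Z.of_nat (length T) <= N * N.
Proof.
  assert (V0 : comb_valid (0, 0)) by (unfold comb_valid; simpl; lia).
  assert (St : forall a : zpos, comb_valid a -> In a comb_states)
    by (intros a Ha; now apply comb_states_in).
  exists (tile_set zpos zpos comb_code comb_face comb_states),
    (state_tile zpos zpos comb_code comb_face (0, 0)), (0, 0).
  split; [apply NoDup_nodup|].
  split; [apply (root_in_tile_set zpos zpos zpos comb_code comb_face comb_states comb_valid
            (fun a => a) (0, 0)); auto|].
  split; [apply (tile_set_restricted zpos zpos comb_code comb_face comb_states (0, 0) DW); auto|].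
  assert (G := growth_theorem zpos zpos zpos comb_code (fun _ => true) comb_face comb_states
    comb_valid (fun a => a) (fun a => a) comb_lt (0, 0)).
  destruct G with (X := square N) (cells := comb_states) as [G1 G2];
    clear G; auto using comb_lt_wf, comb_parent.
  - intros [x y] [x' y'] E. apply lcode_inj in E. simpl in E. congruence.
  - intros [x y] Hz (_ & _ & Hl). unfold comb_valid in Hz. simpl in *. lia.
  - intros a s d l Ha Hs _ F1 F2.
    apply comb_states_in in Hs.
    destruct (comb_edge a s d l Ha Hs F1 F2) as [E Hc].
    exists s. split; [auto|]. split; [auto|]. destruct Hc; auto.
  - intros; discriminate.
  - intros a Ha Hr. left. intros e He. exfalso. destruct a as [x y]. apply Hr.
    unfold comb_valid in Ha. simpl in Ha.
    destruct e; simpl in He.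
    + destruct (_ && _); discriminate.
    + destruct (_ <? _); discriminate.
    + destruct (_ && _); discriminate.
    + destruct (Z.ltb_spec 0 x); [discriminate|]. destruct (Z.eqb_spec y 0); [|discriminate].
      f_equal; lia.
  - intros [x y]. unfold square, comb_valid. simpl. split; [|intros (a & Ha & E); subst a; exact Ha].
    intro Hs. exists (x, y). auto.
  - split; [auto|]. split; [auto|].
    pose proof (tile_set_length zpos zpos comb_code comb_face comb_states) as Hl.
    assert (Hn : length comb_states = (Z.to_nat N * Z.to_nat N)%nat)
      by (unfold comb_states, zpos; now rewrite length_prod, !zrange_length).
    nia.
Qed.

End Comb.

(** * The number of tile types *)

(** The side [4 * m + 1 + depth + (4 * n + 3)] takes every residue modulo 4 as [depth] runs from 1
    to 4. The lower bound on [N] makes the strips thin and [m] positive. *)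
Lemma pinwheel_square (n N : Z) : 2 <= n -> 8 * n + 16 <= N -> N <= n ^ n ->
  exists (T : list tile) (s0 : tile) (p : zpos),
    NoDup T /\ In s0 T /\ glue_restricted T /\
    directed T 1 (single_seed s0 p) /\
    strictly_self_assembles T 1 (single_seed s0 p) (square N) /\
    Z.of_nat (length T) <= 4 * (4 * n + 3) * 6 + 512 * n + 194.
Proof.
  intros Hn Hlow Hup.
  set (m := (N - 4 * n - 5) / 4). set (dl := N - 4 * n - 4 - 4 * m).
  assert (Hm : 4 * m <= N - 4 * n - 5 < 4 * m + 4)
    by (unfold m; Z.to_euclidean_division_equations; lia).
  destruct (pinwheel n n m dl) as (T & s0 & p & H1 & H2 & H3 & H4 & H5 & H6);
    unfold dl; try lia.
  exists T, s0, p. repeat (split; [assumption|]). split.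
  - replace N with (4 * m + 1 + dl + (4 * n + 3)) by (unfold dl; lia). exact H5.
  - assert (dl + 2 <= 6) by (unfold dl; lia). nia.
Qed.

Lemma self_power_bracket (N : nat) : (2 <= N)%nat ->
  exists n, (2 <= n)%nat /\ (N <= n ^ n)%nat /\ (n = 2 \/ (n - 1) ^ (n - 1) < N)%nat.
Proof.
  intro HN.
  assert (Ex : exists n, (2 <= n)%nat /\ (N <= n ^ n)%nat).
  { exists N. split; auto. rewrite <- (Nat.pow_1_r N) at 1. apply Nat.pow_le_mono_r; lia. }
  destruct Ex as (n & Hn2 & Hn). revert Hn2 Hn.
  induction n as [n IH] using (well_founded_induction Nat.lt_wf_0).
  intros Hn2 Hn. destruct (Nat.eq_dec n 2) as [->|D]; [exists 2%nat; auto|].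
  destruct (Nat.le_gt_cases N ((n - 1) ^ (n - 1))) as [C|C].
  - apply (IH (n - 1)%nat); lia.
  - exists n. auto.
Qed.

Open Scope R_scope.

Lemma ln_le_sub1 x : 0 < x -> ln x <= x - 1.
Proof. intro Hx. pose proof (exp_ineq1_le (ln x)). rewrite exp_ln in H; lra. Qed.

Lemma ln2_half : / 2 < ln 2 < 1.
Proof.
  pose proof ln_lt_2. split; [lra|]. pose proof (exp_ineq1 1).
  rewrite <- ln_exp. apply ln_increasing; lra.
Qed.

Lemma ln_le x y : 0 < x -> x <= y -> ln x <= ln y.
Proof. intros Hx [Hy| ->]; [left; now apply ln_increasing|lra]. Qed.

Lemma inv_ln2 : 0 < / ln 2 <= 2.
Proof.
  pose proof ln2_half. split; [apply Rinv_0_lt_compat; lra|].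
  apply Rmult_le_reg_r with (ln 2); [lra|]. rewrite Rinv_l; lra.
Qed.

(* With p ^ p < N and L = log N: either p >= sqrt L, and then log L <= 2 log p, or p < sqrt L. *)
Lemma self_power_log (p L : R) : 2 <= p -> p * ln p <= L * ln 2 -> 1 <= L ->
  (p + 1) * (ln L / ln 2) <= 16 * L.
Proof.
  intros Hp Hl HL. pose proof ln2_half as [H2 H2'].
  pose proof inv_ln2 as Hi.
  assert (HlnL : 0 <= ln L) by (rewrite <- ln_1; apply ln_le; lra).
  assert (Main : (p + 1) * ln L <= 8 * L).
  { destruct (Rle_dec L (p * p)) as [C|C].
    - assert (Q : ln L <= 2 * ln p).
      { replace (2 * ln p) with (ln (p * p)) by (rewrite ln_mult; lra). apply ln_le; lra. }
      nra.
    - assert (Hs : 0 < sqrt L) by (apply sqrt_lt_R0; lra).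
      assert (HsL : sqrt L * sqrt L = L) by (apply sqrt_sqrt; lra).
      assert (Q : ln L <= 2 * sqrt L).
      { rewrite <- HsL at 1. rewrite ln_mult by auto. pose proof (ln_le_sub1 _ Hs). lra. }
      assert (p <= sqrt L) by nra. nra. }
  unfold Rdiv. rewrite <- Rmult_assoc. nra.
Qed.

Lemma INR_Z_le (n : nat) (z : Z) (c : R) : (Z.of_nat n <= z)%Z -> IZR z <= c -> INR n <= c.
Proof. intros H1 H2. rewrite INR_IZR_INZ. apply IZR_le in H1. lra. Qed.

(** The bound is a product rather than a quotient because the iterated logarithm vanishes at
    [N = 2]. *)
Theorem theorem1 :
  exists C : R, forall N : nat, (2 <= N)%nat ->
    exists (T : list tile) (s0 : tile) (p : zpos),
      NoDup T /\ In s0 T /\ glue_restricted T /\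
      directed T 1%Z (single_seed s0 p) /\
      strictly_self_assembles T 1%Z (single_seed s0 p) (square (Z.of_nat N)) /\
      (INR (length T) * log2r (log2r (INR N)) <= C * log2r (INR N))%R.
Proof.
  (* Small squares need [2 * 65536], large ones [16 * 1000]. *)
  exists 200000. intros N HN.
  pose proof ln2_half as [L2 L2'].
  assert (HNR : 2 <= INR N) by (apply (le_INR 2); lia).
  assert (HL : 1 <= log2r (INR N)).
  { unfold log2r. apply Rmult_le_reg_r with (ln 2); [lra|].
    unfold Rdiv. rewrite Rmult_assoc, Rinv_l, Rmult_1_r, Rmult_1_l by lra. apply ln_le; lra. }
  set (L := log2r (INR N)) in *.
  assert (HlnL : 0 <= ln L) by (rewrite <- ln_1; apply ln_le; lra).
  assert (HLL : 0 <= log2r L <= 2 * L).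
  { unfold log2r, Rdiv.
    pose proof inv_ln2 as Hi.
    pose proof (ln_le_sub1 L). nra. }
  (* Beyond [256 = 4 ^ 4] the base [n] is at least 5, which leaves room for the margin
     [8 * n + 16]. *)
  destruct (le_lt_dec N 256) as [Small|Large].
  - destruct (comb (Z.of_nat N)) as (T & s0 & p & H1 & H2 & H3 & H4 & H5 & H6); [lia|].
    exists T, s0, p. repeat (split; [assumption|]).
    assert (Q : INR (length T) <= 65536) by (eapply INR_Z_le; [exact H6|apply IZR_le; nia]).
    apply Rle_trans with (65536 * (2 * L)); [|lra].
    apply Rmult_le_compat; try lra. apply pos_INR.
  - destruct (self_power_bracket N HN) as (n & Hn2 & Hn & Hlow).
    assert (Hn5 : (5 <= n)%nat).
    { destruct (Nat.le_gt_cases 5 n); auto. exfalso.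
      assert (n ^ n <= 4 ^ 4)%nat; [|simpl in *; lia].
      transitivity (4 ^ n)%nat; [apply Nat.pow_le_mono_l; lia|apply Nat.pow_le_mono_r; lia]. }
    destruct Hlow as [Hlow|Hlow]; [lia|].
    assert (Hbig : (8 * n + 16 <= N)%nat).
    { assert ((n - 1) ^ 4 <= (n - 1) ^ (n - 1))%nat by (apply Nat.pow_le_mono_r; lia).
      assert (64 * (n - 1) <= (n - 1) ^ 4)%nat.
      { replace ((n - 1) ^ 4)%nat with ((n - 1) ^ 3 * (n - 1))%nat by (simpl; ring).
        apply Nat.mul_le_mono_r. change 64%nat with (4 ^ 3)%nat.
        apply Nat.pow_le_mono_l. lia. }
      lia. }
    destruct (pinwheel_square (Z.of_nat n) (Z.of_nat N))
      as (T & s0 & p & H1 & H2 & H3 & H4 & H5 & H6); try lia.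
    { rewrite <- Nat2Z.inj_pow. lia. }
    exists T, s0, p. repeat (split; [assumption|]).
    assert (Hnp : INR n = INR (n - 1) + 1) by (rewrite minus_INR by lia; simpl; lra).
    assert (Hp2 : 2 <= INR (n - 1)) by (apply (le_INR 2); lia).
    (* The count is at most [608 * n + 266]. *)
    assert (HT : INR (length T) <= 1000 * (INR (n - 1) + 1)).
    { eapply INR_Z_le; [exact H6|]. rewrite <- Hnp, INR_IZR_INZ.
      rewrite <- mult_IZR. apply IZR_le. lia. }
    assert (Hpp : INR (n - 1) * ln (INR (n - 1)) <= L * ln 2).
    { unfold L, log2r, Rdiv. rewrite Rmult_assoc, Rinv_l, Rmult_1_r by lra.
      rewrite <- ln_pow by lra. apply ln_le; [apply pow_lt; lra|].
      rewrite <- pow_INR. apply le_INR. lia. }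
    pose proof (self_power_log _ _ Hp2 Hpp HL) as Q. fold (log2r L) in Q.
    apply Rle_trans with (1000 * (INR (n - 1) + 1) * log2r L); [|lra].
    apply Rmult_le_compat_r; lra.
Qed.
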